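(* Let $B\in(0,1]$, $\alpha\ge 0$ and $\alpha_f\ge\alpha$. The asymptotic matching rate of the one-sided allocation satisfies $$\eta_{\mathrm{OS}}(B,\alpha,\alpha_f)=1-\max_{t_1\in[0,1]}F_{\mathrm{OS}}(t_1),$$ where, with $M=2\alpha+(\alpha_f-\alpha)B$, $$F_{\mathrm{OS}}(t_1)=(1-B)\exp\left(-2\alpha e^{-Mt_1}\right)+B\exp\left(-(\alpha+\alpha_f)e^{-Mt_1}\right)+e^{-Mt_1}(1+Mt_1)-1 .$$
   Context: For $b^{\mathrm L},b^{\mathrm R}\in[0,1]$ and a $2\times2$ matrix $\mathbf C=[c_{xy}]$ with non-negative entries, $G_n$ is the random bipartite graph with $n$ supply and $n$ demand nodes in which, independently over nodes, each supply node is of type 2 (flexible) with probability $b^{\mathrm L}$ and of type 1 (regular) otherwise, each demand node is of type 2 with probability $b^{\mathrm R}$ and of type 1 otherwise, and, conditional on types, a supply node of type $x$ and a demand node of type $y$ are connected independently with probability $c_{xy}/n$ ($n$ large). $M_\star(G_n)$ is the maximum matching size and $\eta(b^{\mathrm L},b^{\mathrm R};\mathbf C)=\lim_{n\to\infty}\mathbb E[M_\star(G_n)]/n$ (the limit exists). In the flexibility design problem, $\mathbf C=\begin{bmatrix}2\alpha&\alpha+\alpha_f\\ \alpha+\alpha_f&2\alpha_f\end{bmatrix}$, and the one-sided allocation with budget $B$ is $(b^{\mathrm L},b^{\mathrm R})=(B,0)$, so $\eta_{\mathrm{OS}}(B,\alpha,\alpha_f)=\eta(B,0;\mathbf C)$.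 *)

(* Defs.v *)
From HB Require Import structures.
From mathcomp Require Import all_boot all_order all_algebra.
From mathcomp Require Import all_classical all_reals all_analysis.

Set Implicit Arguments.
Unset Strict Implicit.
Unset Printing Implicit Defensive.

Import Order.TTheory GRing.Theory Num.Theory.
Import numFieldNormedType.Exports.

Local Open Scope classical_set_scope.
Local Open Scope ring_scope.

(* A bipartite graph with n supply and n demand nodes is given by its set of
   edges (i, j), with i a supply node and j a demand node. *)
Definition is_matching (n : nat) (M : {set 'I_n * 'I_n}) : bool :=
  [forall e in M, forall f in M, (e != f) ==> (e.1 != f.1) && (e.2 != f.2)].

Definition max_matching_size (n : nat) (E : {set 'I_n * 'I_n}) : nat :=
  \max_(M : {set 'I_n * 'I_n} | (M \subset E) && is_matching M) #|M|.

(* A node type is an element of 'I_2: 0 is type 1 (regular) and 1 is type 2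
   (flexible). *)
Definition type_prob (R : realType) (b : R) (x : 'I_2) : R :=
  bernoulli_pmf b (x == 1).

(* The minimum with 1 only matters for the finitely many n smaller than some
   entry of C; there it keeps the edge probability in [0, 1]. *)
Definition edge_prob (R : realType) (C : 'M[R]_2) (n : nat) (x y : 'I_2) : R :=
  Num.min 1 (C x y / n%:R).

(* Joint probability mass function of the supply types tL, the demand types tR
   and the edge set E of G_n. *)
Definition graph_pmf (R : realType) (bL bR : R) (C : 'M[R]_2) (n : nat)
    (tL tR : {ffun 'I_n -> 'I_2}) (E : {set 'I_n * 'I_n}) : R :=
  (\prod_(i < n) type_prob bL (tL i)) *
  (\prod_(j < n) type_prob bR (tR j)) *
  (\prod_(e : 'I_n * 'I_n)
     bernoulli_pmf (edge_prob C n (tL e.1) (tR e.2)) (e \in E)).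

Definition expected_max_matching (R : realType) (bL bR : R) (C : 'M[R]_2)
    (n : nat) : R :=
  \sum_(tL : {ffun 'I_n -> 'I_2}) \sum_(tR : {ffun 'I_n -> 'I_2})
    \sum_(E : {set 'I_n * 'I_n})
      graph_pmf bL bR C tL tR E * (max_matching_size E)%:R.

Definition matching_rate (R : realType) (bL bR : R) (C : 'M[R]_2) : R^nat :=
  fun n => expected_max_matching bL bR C n / n%:R.

Definition eta (R : realType) (bL bR : R) (C : 'M[R]_2) : R :=
  limn (matching_rate bL bR C).

Definition flex_matrix (R : realType) (alpha alphaf : R) : 'M[R]_2 :=
  \matrix_(x, y)
    if x == 0 then (if y == 0 then 2 * alpha else alpha + alphaf)
    else (if y == 0 then alpha + alphaf else 2 * alphaf).

Definition eta_OS (R : realType) (B alpha alphaf : R) : R :=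
  eta B 0 (flex_matrix alpha alphaf).

Definition F_OS (R : realType) (B alpha alphaf t1 : R) : R :=
  let M := 2 * alpha + (alphaf - alpha) * B in
  (1 - B) * expR (- (2 * alpha) * expR (- (M * t1)))
  + B * expR (- (alpha + alphaf) * expR (- (M * t1)))
  + expR (- (M * t1)) * (1 + M * t1) - 1.

(* Main.v *)
(* By Koenig's theorem, a maximum matching has size n - d, where the deficiency
   d is the maximum of |T| - |N(T)| over sets T of demand nodes. Since all demand
   nodes are regular, the supply nodes have independent, exchangeable
   neighbourhoods, and adding one of them lowers d by 1 exactly when it meets the
   smallest maximiser A (the critical set). Add also leaves, i.e. supply nodes with
   one uniform neighbour, and let u(r, s) be the mean of d / n with r n leaves and
   s n supply nodes. With a = |A| / n, the increments of d give u_r = - E a and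
   u_s = - E g(a), where g(a) is the limiting probability that a supply node meets
   a given set of a n demand nodes. If a concentrates, this is the
   Hamilton-Jacobi equation u_s = - g(- u_r) with the convex initial condition
   exp(- r), and Hopf's formula at (0, 1) is the maximum of
   exp(- y) (1 + y) - g(exp(- y)), i.e. of F_OS at y = M t.
   The lower bound on u needs no concentration, since g is below its tangents:
   trade supply nodes for leaves at the slope of a tangent. For the upper bound, the
   decrease of d over a window of further leaves bounds a from below and has
   variance O(n), so that u is a subsolution of a monotone difference scheme, of
   which the softmax of the affine solutions is a supersolution. *)

Require Import Defs.
From mathcomp Require Import all_boot all_order all_algebra.
From mathcomp Require Import all_classical all_reals all_analysis.
From mathcomp Require Import zify ring lra.
Import mathcomp.boot.finset.

Set Implicit Arguments.
Unset Strict Implicit.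
Unset Printing Implicit Defensive.

Import Order.TTheory GRing.Theory Num.Theory.
Import numFieldNormedType.Exports.

Local Open Scope ring_scope.

(** * Deficiency and critical set *)

Section Deficiency.
Context {J : finType}.
Implicit Types (N T A : {set J}) (c : {set J} -> nat).

(* A graph is represented by its hit counts: [c T] is the number of supply nodes
   with a neighbour in the set [T] of demand nodes. *)
Definition hit N T : nat := N :&: T != set0.

Definition add_hit N c : {set J} -> nat := fun T => (hit N T + c T)%N.

Definition no_hit : {set J} -> nat := fun=> 0%N.

(** Truncated subtraction is harmless: when [c set0 = 0] the empty set already contributes 0. *)
Definition deficiency c : nat := \max_(T : {set J}) (#|T| - c T).

Definition submodular c : Prop :=
  c set0 = 0%N /\ forall T T', (c (T :|: T') + c (T :&: T') <= c T + c T')%N.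

Lemma hit0 N : hit N set0 = 0%N.
Proof. by rewrite /hit setI0 eqxx. Qed.

Lemma hit_le1 N T : (hit N T <= 1)%N.
Proof. exact: leq_b1. Qed.

Lemma hitS N T T' : T \subset T' -> (hit N T <= hit N T')%N.
Proof.
move=> sTT'; rewrite /hit; have [|NT] := eqVneq (N :&: T) set0; first by [].
by rewrite (subset_neq0 (setIS N sTT') NT).
Qed.

Lemma hitU_le N T T' : (hit N (T :|: T') <= hit N T + hit N T')%N.
Proof. by rewrite /hit setIUr setU_eq0 negb_and; do 2 case: eqP. Qed.

Lemma submodular_add_hit N c : submodular c -> submodular (add_hit N c).
Proof.
move=> [c0 csub]; split; first by rewrite /add_hit hit0 c0.
move=> T T'; have := csub T T'; rewrite /add_hit.
have : (hit N (T :|: T') + hit N (T :&: T') <= hit N T + hit N T')%N.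
  have := hitS N (subsetIl T T'); have := hitS N (subsetIr T T').
  have := hitU_le N T T'; have := hit_le1 N (T :|: T').
  have := hit_le1 N (T :&: T'); lia.
lia.
Qed.

Lemma submodular_no_hit : submodular no_hit. Proof. by []. Qed.

Lemma add_hitC N N' c : add_hit N (add_hit N' c) = add_hit N' (add_hit N c).
Proof. by apply/funext => T; rewrite /add_hit addnCA. Qed.

Lemma add_hit0 c : add_hit set0 c = c.
Proof. by apply/funext => T; rewrite /add_hit /hit set0I eqxx. Qed.

Lemma leq_deficiency c T : (#|T| <= deficiency c + c T)%N.
Proof.
by rewrite addnC -leq_subLR; exact: (leq_bigmax_cond (F := fun T => (#|T| - c T)%N)).
Qed.

Lemma deficiency_le c m :
  (forall T, #|T| <= m + c T)%N -> (deficiency c <= m)%N.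
Proof. by move=> cm; apply/bigmax_leqP => T _; have := cm T; lia. Qed.

Lemma deficiency_add_hit_ge N c : (deficiency c <= (deficiency (add_hit N c)).+1)%N.
Proof.
apply: deficiency_le => T; have := leq_deficiency (add_hit N c) T.
by rewrite /add_hit; have := hit_le1 N T; lia.
Qed.

Lemma deficiency_add_hit_le N c : (deficiency (add_hit N c) <= deficiency c)%N.
Proof.
by apply: deficiency_le => T; have := leq_deficiency c T; rewrite /add_hit; lia.
Qed.

Definition tight c T := (#|T| == deficiency c + c T)%N.

(* For the hit counts of a graph, the demand nodes that some maximum matching
   leaves uncovered. *)
Definition critical_set c : {set J} := \bigcap_(T | tight c T) T.

Lemma tight_exists c : c set0 = 0%N -> exists T, tight c T.
Proof.
move=> c0; case: (posnP (deficiency c)) => [d0|d0].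
  by exists set0; rewrite /tight cards0 d0 c0.
have [|T dT] := @bigop.eq_bigmax {set J} (fun T => #|T| - c T)%N.
  by apply/card_gt0P; exists set0.
exists T; apply/eqP; move: d0; rewrite /deficiency dT; lia.
Qed.

(** Cardinality is modular and [c] submodular, so the excesses of union and intersection sum to at
    least twice the deficiency; neither exceeds it, so both attain it. *)
Lemma tightI c T T' : submodular c -> tight c T -> tight c T' ->
  tight c (T :&: T').
Proof.
move=> [_ csub] /eqP tT /eqP tT'; apply/eqP; have := csub T T'.
have := leq_deficiency c (T :|: T'); have := leq_deficiency c (T :&: T').
by have := cardsUI T T'; lia.
Qed.

Lemma critical_set_sub c T : tight c T -> critical_set c \subset T.
Proof. by move=> tT; apply: bigcap_inf. Qed.

Lemma critical_set_tight c : submodular c -> tight c (critical_set c).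
Proof.
move=> cs; have [T0 tT0] := tight_exists cs.1.
(* A tight set of least size lies in every tight set, as their intersection is tight again. *)
case: (arg_minnP (fun T => #|T|) tT0) => A tA Amin.
suff -> : critical_set c = A by [].
apply/eqP; rewrite eqEsubset critical_set_sub//=.
apply/bigcapsP => T tT; apply/setIidPl/eqP.
by rewrite eqEcard subsetIl Amin// tightI.
Qed.

(** If [N] misses the critical set, that set keeps its excess. If [N] meets it, [N] meets every
    tight set, so all of these lose one, while the other sets were already below the maximum. *)
Lemma deficiency_add_hit N c : submodular c ->
  (deficiency (add_hit N c) + hit N (critical_set c))%N = deficiency c.
Proof.
move=> cs; set A := critical_set c.
have /eqP := critical_set_tight cs; rewrite -/A => tA.
apply/eqP; rewrite eqn_leq; apply/andP; split; last first.
  by have := leq_deficiency (add_hit N c) A; rewrite [add_hit N c A]/add_hit; lia.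
have [->|hA] : hit N A = 0%N \/ hit N A = 1%N.
- by have := hit_le1 N A; lia.
- by rewrite addn0 deficiency_add_hit_le.
(* Deficiency 0 would make the critical set empty, and nothing hits the empty set. *)
have d0 : (0 < deficiency c)%N.
  rewrite lt0n; apply/eqP => d0; move: hA.
  have : A \subset set0 by apply: critical_set_sub; rewrite /tight cards0 d0 cs.1.
  by rewrite subset0 => /eqP ->; rewrite hit0.
suff : (deficiency (add_hit N c) <= (deficiency c).-1)%N by move=> ?; rewrite hA; lia.
apply: deficiency_le => T; rewrite /add_hit.
have := leq_deficiency c T; rewrite leq_eqVlt => /orP[tT|]; last by lia.
have := hitS N (critical_set_sub tT); rewrite -/A hA; move/eqP: tT; lia.
Qed.

Lemma deficiency_le_critical c : submodular c ->
  (deficiency c <= #|critical_set c|)%N.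
Proof. by move=> /critical_set_tight /eqP ->; rewrite leq_addr. Qed.

Definition unhit c : {set J} := [set j | c [set j] == 0%N].

Lemma unhit_le_deficiency c : submodular c -> (#|unhit c| <= deficiency c)%N.
Proof.
move=> [c0 csub]; suff : c (unhit c) = 0%N.
  by move=> cU; have := leq_deficiency c (unhit c); rewrite cU addn0.
suff : forall s : seq J, {subset s <= unhit c} -> c [set:: s] = 0%N.
  move=> /(_ (enum (unhit c))); rewrite set_enum; apply.
  by move=> j; rewrite mem_enum.
elim => [|j s IH] us; first by rewrite set_nil.
have := csub [set j] [set:: s]; rewrite set_cons IH; last first.
  by move=> k ks; apply: us; rewrite inE ks orbT.
have := us j (mem_head _ _); rewrite inE => /eqP ->; lia.
Qed.

Lemma unhit_add_hit N c : unhit (add_hit N c) = unhit c :\: N.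
Proof.
apply/setP => j; rewrite !inE /add_hit addn_eq0; congr andb.
by rewrite /hit eqb0 negbK setI_eq0 disjoint_sym disjoints1.
Qed.

End Deficiency.

(** * Independent supply nodes *)

Section Expectation.
Context {R : realType} {J : finType}.
Implicit Types (N T A : {set J}) (c : {set J} -> nat).

Record law := Law {
  pmf :> {set J} -> R;
  pmf_ge0 : forall N, 0 <= pmf N;
  pmf_sum1 : \sum_N pmf N = 1 }.

Implicit Types (mu nu : law) (l : seq law) (f g : ({set J} -> nat) -> R).

(** Averaging over one new supply node, as an operator on functions of the state; independent nodes
    correspond to composition. *)
Definition step mu f : ({set J} -> nat) -> R :=
  fun c => \sum_N mu N * f (add_hit N c).

Definition expectation l f : ({set J} -> nat) -> R := foldr step f l.

Lemma step_cst mu (k : R) c : step mu (fun=> k) c = k.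
Proof. by rewrite /step -mulr_suml pmf_sum1 mul1r. Qed.

Lemma step_linear mu (k : R) f g c :
  step mu (fun c => k * f c + g c) c = k * step mu f c + step mu g c.
Proof.
rewrite /step mulr_sumr -big_split/=; apply: eq_bigr => N _.
by rewrite mulrDr mulrCA.
Qed.

Lemma step_le mu f g c : (forall N, f (add_hit N c) <= g (add_hit N c)) ->
  step mu f c <= step mu g c.
Proof. by move=> fg; apply: ler_sum => N _; rewrite ler_wpM2l ?pmf_ge0. Qed.

Lemma stepC mu nu f : step mu (step nu f) = step nu (step mu f).
Proof.
apply/funext => c; rewrite /step.
under eq_bigr do rewrite mulr_sumr.
rewrite exchange_big/=; apply: eq_bigr => N _; rewrite mulr_sumr.
by apply: eq_bigr => N' _; rewrite add_hitC mulrCA.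
Qed.

Lemma expectation_cat l1 l2 f :
  expectation (l1 ++ l2) f = expectation l1 (expectation l2 f).
Proof. by rewrite /expectation foldr_cat. Qed.

(** Exchangeability: the node added first can be added last instead. *)
Lemma expectation_cons mu l f : expectation (mu :: l) f = expectation l (step mu f).
Proof. by elim: l => //= nu l <-; rewrite stepC. Qed.

Lemma expectation_cst l (k : R) c : expectation l (fun=> k) c = k.
Proof.
elim: l c => //= mu l IH c; rewrite -[RHS](step_cst mu k c).
by apply: eq_bigr => N _; rewrite IH.
Qed.

Lemma expectation_linear l (k : R) f g c :
  expectation l (fun c => k * f c + g c) c = k * expectation l f c + expectation l g c.
Proof.
elim: l c => //= mu l IH c; rewrite -step_linear.
by apply: eq_bigr => N _; rewrite IH.
Qed.

Lemma expectation_affine l (k b : R) f c :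
  expectation l (fun c => k * f c + b) c = k * expectation l f c + b.
Proof. by rewrite (expectation_linear l k f (fun=> b)) expectation_cst. Qed.

Lemma expectation_sub l f g c :
  expectation l (fun c => f c - g c) c = expectation l f c - expectation l g c.
Proof.
rewrite -mulN1r addrC -expectation_linear; congr expectation.
by apply/funext => c'; rewrite mulN1r addrC.
Qed.

Lemma expectation_le l f g c : submodular c ->
  (forall c, submodular c -> f c <= g c) -> expectation l f c <= expectation l g c.
Proof.
move=> + fg; elim: l c => [|mu l IH] c cs /=; first exact: fg.
by apply: step_le => N; apply/IH/submodular_add_hit.
Qed.

Definition slow f := forall c N, 0 <= f c - f (add_hit N c) <= 1.

Lemma slow_step mu f : slow f -> slow (step mu f).
Proof.
move=> fs c N.
have -> : step mu f c - step mu f (add_hit N c) =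
    step mu (fun c => f c - f (add_hit N c)) c.
  rewrite /step -sumrB; apply: eq_bigr => N' _.
  by rewrite mulrBr [add_hit N (add_hit N' c)]add_hitC.
apply/andP; split.
  by rewrite -(step_cst mu 0 c); apply: step_le => N'; case/andP: (fs (add_hit N' c) N).
rewrite -[leRHS](step_cst mu 1 c); apply: step_le => N'.
by case/andP: (fs (add_hit N' c) N).
Qed.

Lemma slow_expectation l f : slow f -> slow (expectation l f).
Proof. by move=> fs; elim: l => //= mu l; apply: slow_step. Qed.

Definition lipschitz1 f := forall c N, `|f (add_hit N c) - f c| <= 1.

Lemma lipschitz1_sub f g : slow f -> slow g -> lipschitz1 (fun c => f c - g c).
Proof.
by move=> fs gs c N; have := fs c N; have := gs c N; rewrite ler_norml; lra.
Qed.

Lemma lipschitz1_step mu f : lipschitz1 f -> lipschitz1 (step mu f).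
Proof.
move=> fl c N; rewrite /step -sumrB; apply: le_trans (ler_norm_sum _ _ _) _.
rewrite -[leRHS](pmf_sum1 mu); apply: ler_sum => N' _.
by rewrite -mulrBr normrM ger0_norm ?pmf_ge0// ler_piMr ?pmf_ge0// add_hitC fl.
Qed.

Lemma lipschitz1_expectation l f : lipschitz1 f -> lipschitz1 (expectation l f).
Proof. by move=> fl; elim: l => //= mu l; apply: lipschitz1_step. Qed.

(* Efron-Stein for functions with increments at most 1. *)
Lemma expectation_sqr_le l f (z : R) c : lipschitz1 f ->
  expectation l (fun c => (f c - z) ^+ 2) c <=
  (size l)%:R + (expectation l f c - z) ^+ 2.
Proof.
move=> fl; elim: l c => [|mu l IH] c /=; first by rewrite add0r.
set Y := expectation l f in IH *.
apply: (@le_trans _ _ (step mu (fun c => (size l)%:R + (Y c - z) ^+ 2) c)).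
  by apply: step_le => N; exact: IH.
(* Squared deviation from [z] is squared bias plus variance; the variance over one new node is
   computed around the old value [Y c], which is within 1 of the new one. *)
have -> : step mu (fun c => (size l)%:R + (Y c - z) ^+ 2) c =
    (size l)%:R + (step mu Y c - z) ^+ 2
    + (step mu (fun c' => (Y c' - Y c) ^+ 2) c - (step mu Y c - Y c) ^+ 2).
  have -> : step mu (fun c' => (Y c' - Y c) ^+ 2) c =
     step mu (fun c' => (2 * z - 2 * Y c) * Y c' +
       (1 * ((size l)%:R + (Y c' - z) ^+ 2) + ((Y c) ^+ 2 - z ^+2 - (size l)%:R))) c.
    by apply: eq_bigr => N _; congr (_ * _); ring.
  by rewrite 2!step_linear step_cst; ring.
suff : step mu (fun c' => (Y c' - Y c) ^+ 2) c <= 1.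
  by have := sqr_ge0 (step mu Y c - Y c); rewrite -natr1; lra.
rewrite -[leRHS](step_cst mu 1 c); apply: step_le => N.
by rewrite -real_normK ?num_real// expr_le1// (lipschitz1_expectation l fl).
Qed.

Definition hit_prob mu T : R := \sum_N mu N * (hit N T)%:R.

Definition deficiencyR c : R := (deficiency c)%:R.

Lemma slow_deficiency : slow deficiencyR.
Proof.
move=> c N; rewrite /deficiencyR; have := deficiency_add_hit_ge N c.
have := deficiency_add_hit_le N c; rewrite -!(ler_nat R) -[_.+1]addn1 natrD; lra.
Qed.

Lemma step_deficiency mu c : submodular c ->
  step mu deficiencyR c = deficiencyR c - hit_prob mu (critical_set c).
Proof.
move=> cs; rewrite -[X in X - _](step_cst mu (deficiencyR c) c) /step -sumrB.
apply: eq_bigr => N _; rewrite -mulrBr /deficiencyR -(deficiency_add_hit N cs).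
by rewrite natrD addrK.
Qed.

Lemma expectation_nseq_hit n mu c T :
  expectation (nseq n mu) (fun c => (c T)%:R) c = (c T)%:R + n%:R * hit_prob mu T.
Proof.
elim: n c => [|n IH] c /=; first by rewrite mul0r addr0.
rewrite -natr1 mulrDl mul1r.
transitivity (step mu (fun c => 1 * (c T)%:R + n%:R * hit_prob mu T) c).
  by apply: eq_bigr => N _; rewrite IH mul1r.
rewrite step_linear step_cst mul1r.
suff -> : step mu (fun c => (c T)%:R) c = (c T)%:R + hit_prob mu T by ring.
rewrite -[X in X + _](step_cst mu (c T)%:R c) /step -big_split/=.
by apply: eq_bigr => N _; rewrite -mulrDr -natrD addnC.
Qed.

End Expectation.
Arguments law : clear implicits.

(** * Leaves: supply nodes with one uniform neighbour *)

Section Leaf.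
Context {R : realType} {J : finType} (J0 : (0 < #|J|)%N).
Implicit Types (N T A : {set J}) (c : {set J} -> nat).
Local Notation n := (#|J|).

Lemma expectation_catC (l1 l2 : seq (law R J)) (f : ({set J} -> nat) -> R) :
  expectation (l1 ++ l2) f = expectation l2 (expectation l1 f).
Proof.
by elim: l1 f => // mu l1 IH f; rewrite cat_cons !expectation_cons IH.
Qed.

Lemma expectation_slow_le (l : seq (law R J)) (f : ({set J} -> nat) -> R) c :
  slow f -> expectation l f c <= f c.
Proof.
move=> fs; elim: l c => //= mu l IH c.
rewrite -[leRHS](step_cst mu (f c) c); apply: step_le => N.
by apply: le_trans (IH _) _; case/andP: (fs c N); lra.
Qed.

Definition leaf_pmf N : R := (\sum_j (N == [set j])%:R) / n%:R.

Lemma leaf_pmf_ge0 N : 0 <= leaf_pmf N.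
Proof. by rewrite /leaf_pmf divr_ge0// sumr_ge0. Qed.

Lemma sum_leaf_pmf (F : {set J} -> R) :
  \sum_N leaf_pmf N * F N = (\sum_j F [set j]) / n%:R.
Proof.
under eq_bigr do rewrite /leaf_pmf mulrAC mulr_suml.
rewrite -mulr_suml exchange_big/=; congr (_ / _); apply: eq_bigr => j _.
rewrite (bigD1 [set j])//= eqxx mul1r big1 ?addr0// => N /negPf ->.
by rewrite mul0r.
Qed.

Lemma leaf_pmf_sum1 : \sum_N leaf_pmf N = 1.
Proof.
under eq_bigr do rewrite -[leaf_pmf _]mulr1.
by rewrite sum_leaf_pmf sumr_const divff// pnatr_eq0 -lt0n.
Qed.

Definition leaf : law R J := Law leaf_pmf_ge0 leaf_pmf_sum1.

Lemma hit1 (j : J) T : hit [set j] T = (j \in T).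
Proof. by rewrite /hit setI_eq0 disjoints1 negbK. Qed.

Lemma hit_prob_leaf T : hit_prob leaf T = #|T|%:R / n%:R :> R.
Proof.
rewrite /hit_prob sum_leaf_pmf; congr (_ / _).
under eq_bigr do rewrite hit1.
by rewrite -natr_sum -big_mkcond sum1_card.
Qed.

(** The initial critical set [A] is kept as a test set after the leaves: the deficiency is at least
    #|A| minus the hits of [A], whose number grows on average by #|A| / n per leaf. *)
Lemma leaves_deficiency_ge h c : submodular c ->
  deficiencyR c - h%:R * (#|critical_set c|%:R / n%:R)
  <= expectation (nseq h leaf) (@deficiencyR R J) c.
Proof.
move=> cs; set A := critical_set c; rewrite -hit_prob_leaf.
have -> : deficiencyR c - h%:R * hit_prob leaf A =
    expectation (nseq h leaf) (fun c => -1 * (c A)%:R + #|A|%:R) c.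
  rewrite expectation_affine expectation_nseq_hit /deficiencyR.
  have /eqP -> := critical_set_tight cs; rewrite natrD -/A; ring.
apply: expectation_le => // c' _; rewrite /deficiencyR.
by have := leq_deficiency c' A; rewrite -(ler_nat R) natrD; lra.
Qed.

Definition mean_deficiency (l : seq (law R J)) : R :=
  expectation l deficiencyR no_hit.
Local Notation D := mean_deficiency.

(* The loss of deficiency over [h] leaves bounds the size of the critical set
   from below, up to fluctuations controlled by the variance bound. *)
Lemma deficiency_scheme (G : R -> R) (M t : R) (h : nat) (mu : law R J)
    (l : seq (law R J)) :
  (forall x y : R, 0 <= x -> x <= y -> G x <= G y) ->
  (forall x y : R, 0 <= x -> x <= y -> G y <= G x + M * (y - x)) ->
  (forall T, G (#|T|%:R / n%:R) <= hit_prob mu T) ->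
  0 <= M -> 0 < t -> (0 < h)%N ->
  D (mu :: l) <= D l - G ((D l - D (nseq h leaf ++ l)) / h%:R)
    + M / h%:R * (((size l)%:R / t + t) / 2).
Proof.
move=> Gmono Glip Gmu M0 t0 h0.
have h0R : 0 < h%:R :> R by rewrite ltr0n.
(* [X c / h] bounds the density of the critical set of [c] from below, and Efron-Stein keeps [X]
   close to its mean [x]. *)
pose X c : R := deficiencyR c - expectation (nseq h leaf) deficiencyR c.
have X0 c : 0 <= X c by rewrite subr_ge0 expectation_slow_le//; exact: slow_deficiency.
have EX : expectation l X no_hit = D l - D (nseq h leaf ++ l).
  by rewrite /X expectation_sub /mean_deficiency expectation_catC.
have X1 : lipschitz1 X.
  by apply: lipschitz1_sub; [|apply: slow_expectation]; exact: slow_deficiency.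
set x := D l - _ in EX *.
have x0 : 0 <= x.
  rewrite -EX -(expectation_cst l 0 no_hit).
  by apply: expectation_le => // *; exact: X0.
have key c : submodular c -> step mu deficiencyR c <=
    (M / h%:R / (2 * t)) * (X c - x) ^+ 2
    + (1 * deficiencyR c + (M / h%:R * (t / 2) - G (x / h%:R))).
  move=> cs; rewrite step_deficiency//; set A := critical_set c.
  have XA : X c / h%:R <= #|A|%:R / n%:R.
    rewrite ler_pdivrMr// mulrC /X.
    by have := leaves_deficiency_ge h cs; rewrite -/A; lra.
  have GX : G (X c / h%:R) <= G (#|A|%:R / n%:R) by rewrite Gmono ?divr_ge0.
  have xX : G (x / h%:R) <= G (X c / h%:R) + M / h%:R * `|X c - x|.
    have [xX|Xx] := leP x (X c).
      apply: le_trans (_ : G (X c / h%:R) <= _).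
        by rewrite Gmono ?divr_ge0// ler_pM2r ?invr_gt0.
      rewrite lerDl mulr_ge0// divr_ge0//; lra.
    apply: le_trans (Glip (X c / h%:R) _ _ _) _.
    - by rewrite divr_ge0.
    - by rewrite ler_pM2r ?invr_gt0// ltW.
    rewrite lerD2l ltr0_norm ?subr_lt0//.
    by rewrite [leRHS](_ : _ = M * (x / h%:R - X c / h%:R)) ?lexx//; ring.
  have amgm : `|X c - x| <= (X c - x) ^+ 2 / (2 * t) + t / 2.
    rewrite -real_normK ?num_real//; set w := `|_|.
    rewrite -subr_ge0 (_ : _ - _ = (w - t) ^+ 2 / (2 * t)); last by field; lra.
    by rewrite divr_ge0 ?sqr_ge0//; lra.
  have := ler_wpM2l (divr_ge0 M0 (ltW h0R)) amgm.
  have := Gmu A; set u := (X c - x) ^+ 2.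
  set v := M / h%:R in xX *; set w := G (x / _) in xX *.
  rewrite mulrDr (_ : v * (u / (2 * t)) = v / (2 * t) * u); last by ring.
  by move=> ? ?; lra.
rewrite {1}/mean_deficiency expectation_cons.
apply: le_trans (expectation_le l submodular_no_hit key) _.
rewrite 2!expectation_linear expectation_cst mul1r -/(D l).
have := expectation_sqr_le l x no_hit X1; rewrite EX subrr expr0n addr0 => V.
have W : 0 <= M / h%:R / (2 * t) by rewrite !divr_ge0//; lra.
have := ler_wpM2l W V.
rewrite (_ : M / h%:R / (2 * t) * (size l)%:R =
  M / h%:R * ((size l)%:R / t / 2)); last first.
  by field; lra.
lra.
Qed.

(** Discarding the nodes of [l] can only raise the deficiency, and each leaf multiplies its mean by
    at most 1 - 1/n, because the critical set has at least [deficiency c] elements. *)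
Lemma expectation_leaves_le k (l : seq (law R J)) :
  D (nseq k leaf ++ l) <= n%:R * expR (- (k%:R / n%:R)).
Proof.
have n0 : 0 < n%:R :> R by rewrite ltr0n.
apply: le_trans (_ : D (nseq k leaf) <= _).
  rewrite /mean_deficiency expectation_cat; apply: expectation_le => // c _.
  by apply: expectation_slow_le; exact: slow_deficiency.
elim: k => [|k IH].
  rewrite /= mul0r oppr0 expR0 mulr1 /deficiencyR ler_nat.
  by apply: deficiency_le => T; rewrite addn0 max_card.
rewrite /mean_deficiency expectation_cons.
apply: le_trans (_ : expectation (nseq k leaf)
   (fun c => (1 - n%:R^-1) * deficiencyR c + 0) no_hit <= _).
  apply: expectation_le => // c cs; rewrite step_deficiency// hit_prob_leaf addr0.
  rewrite mulrBl mul1r lerD2l lerN2 mulrC ler_pM2r ?invr_gt0//.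
  by rewrite ler_nat deficiency_le_critical.
rewrite expectation_affine addr0.
have -> : k.+1%:R / n%:R = k%:R / n%:R + n%:R^-1 :> R by rewrite -natr1 mulrDl div1r.
rewrite opprD expRD.
have n1 : 1 - n%:R^-1 <= expR (- n%:R^-1) :> R by rewrite expR_ge1Dx.
apply: le_trans (ler_wpM2r _ n1) _.
  rewrite -(expectation_cst (nseq k leaf) 0 no_hit).
  by apply: expectation_le => // *; exact: ler0n.
by rewrite mulrA [leRHS]mulrC ler_wpM2l ?expR_ge0.
Qed.

End Leaf.

Lemma expRN_le_quad {R : realType} (x : R) : 0 <= x -> expR (- x) <= 1 - x + x ^+ 2.
Proof.
move=> x0; have x1 : 0 < 1 + x by lra.
rewrite expRN; apply: le_trans (_ : (1 + x)^-1 <= _).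
  by rewrite lef_pV2 ?posrE ?expR_gt0// expR_ge1Dx.
by rewrite -div1r ler_pdivrMr//; have := exprn_ge0 3 x0; lra.
Qed.

(** * The limiting hitting rate *)

Section Rate.
Context {R : realType} {X : finType} (b c : X -> R).
Hypotheses (b0 : forall x, 0 <= b x) (c0 : forall x, 0 <= c x).

(** The function g of the overview: in the limit, a supply node of type [x] has a Poisson number of
    neighbours, of mean c(x) a, in a set of density [a]. *)
Definition rate (a : R) : R := \sum_x b x * (1 - expR (- (c x * a))).

Definition drate (a : R) : R := \sum_x b x * c x * expR (- (c x * a)).

Definition mean_degree : R := \sum_x b x * c x.
Local Notation M := mean_degree.

Lemma mean_degree_ge0 : 0 <= M.
Proof. by apply: sumr_ge0 => x _; rewrite mulr_ge0. Qed.

Lemma rate_homo (x y : R) : x <= y -> rate x <= rate y.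
Proof.
move=> xy; apply: ler_sum => z _; rewrite ler_wpM2l// lerD2l lerN2 ler_expR.
by rewrite lerN2 ler_wpM2l.
Qed.

Lemma rate_tangent (a0 a : R) : rate a <= rate a0 + drate a0 * (a - a0).
Proof.
rewrite /drate mulr_suml -big_split/=; apply: ler_sum => x _.
rewrite -!mulrA -mulrDr ler_wpM2l//.
have -> : - (c x * a) = - (c x * a0) + - (c x * (a - a0)) by ring.
rewrite expRD; have := expR_ge0 (- (c x * a0)).
have := expR_ge1Dx (- (c x * (a - a0))); nra.
Qed.

Lemma drate_ge0 (a : R) : 0 <= drate a.
Proof. by apply: sumr_ge0 => x _; rewrite !mulr_ge0// expR_ge0. Qed.

Lemma drate_le (a : R) : 0 <= a -> drate a <= M.
Proof.
move=> a0; apply: ler_sum => x _; rewrite ler_piMr ?mulr_ge0//.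
by rewrite -expR0 ler_expR oppr_le0 mulr_ge0.
Qed.

Lemma rate_lip (x y : R) : 0 <= x -> x <= y -> rate y <= rate x + M * (y - x).
Proof.
move=> x0 xy; apply: le_trans (rate_tangent x y) _.
by rewrite lerD2l ler_wpM2r ?subr_ge0// drate_le.
Qed.

(** * Softmax of affine solutions of the Hamilton-Jacobi equation *)

Section Softmax.
Context {I : finType} (i0 : I) (al be : I -> R) (beta : R).
Hypotheses (al0 : forall i, 0 <= al i) (al1 : forall i, al i <= 1) (beta0 : 0 < beta).

(** [E] weighs the affine solutions be - al r - s rate(al) of v_s = - rate(- v_r); [bar] is the
    Gibbs average of the slopes [al], that is, minus the r-derivative of [softmax]. *)
Let E r s i := expR (beta * (be i - al i * r - s * rate (al i))).
Let Z r s := \sum_i E r s i.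
Let bar r s := (\sum_i al i * E r s i) / Z r s.

Definition softmax (r s : R) : R := ln (Z r s) / beta.

Let Z_gt0 r s : 0 < Z r s.
Proof.
rewrite /Z (bigD1 i0)//= ltr_pwDl ?expR_gt0// sumr_ge0// => i _; exact: expR_ge0.
Qed.

Let sum_bar r s : \sum_i al i * E r s i = bar r s * Z r s.
Proof. by rewrite /bar divfK// gt_eqF. Qed.

Let softmaxE r s : expR (beta * softmax r s) = Z r s.
Proof. by rewrite /softmax mulrC divfK ?gt_eqF// lnK// posrE. Qed.

(** The tangent of [rate] at [bar r s] bounds every [rate (al i)]; after exp(x) >= 1 + x the linear
    term averages to zero by the choice of [bar]. *)
Let softmax_s r s u : 0 <= u ->
  softmax r s - u * rate (bar r s) <= softmax r (s + u).
Proof.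
move=> u0; rewrite -(ler_pM2l beta0) -ler_expR softmaxE mulrBr expRD softmaxE.
set g := rate (bar r s); set d := drate (bar r s).
apply: le_trans (_ : \sum_i E r s i * (expR (- (beta * (u * g))) *
    (1 - beta * u * d * (al i - bar r s))) <= _); last first.
  apply: ler_sum => i _; rewrite [leRHS]/E.
  have -> : beta * (be i - al i * r - (s + u) * rate (al i)) =
      beta * (be i - al i * r - s * rate (al i)) + (- (beta * (u * g)))
      + beta * u * (g - rate (al i)) by ring.
  rewrite 2!expRD -[leRHS]mulrA ler_wpM2l ?expR_ge0// ler_wpM2l ?expR_ge0//.
  apply: le_trans (expR_ge1Dx _).
  have : - (d * (al i - bar r s)) <= g - rate (al i).
    by have := rate_tangent (bar r s) (al i); rewrite -/g -/d; lra.
  by move=> /(ler_wpM2l (mulr_ge0 (ltW beta0) u0)); lra.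
rewrite le_eqVlt; apply/orP; left; apply/eqP.
transitivity (expR (- (beta * (u * g))) *
  ((1 + beta * u * d * bar r s) * Z r s - beta * u * d * \sum_i al i * E r s i)).
  by rewrite sum_bar; ring.
rewrite !mulr_sumr -sumrB mulr_sumr; apply: eq_bigr => i _; ring.
Qed.

(** Expansion in [r] with slope - [bar]; the quadratic remainder uses 0 <= al <= 1. *)
Let softmax_r r s e : 0 <= e ->
  softmax (r + e) s <= softmax r s - e * bar r s + beta * e ^+ 2.
Proof.
move=> e0; rewrite -(ler_pM2l beta0) -ler_expR softmaxE.
have -> : beta * (softmax r s - e * bar r s + beta * e ^+ 2) =
   beta * softmax r s + (- (beta * e * bar r s) + (beta * e) ^+ 2) by ring.
rewrite expRD softmaxE; set q := beta * e.
have q0 : 0 <= q by rewrite mulr_ge0// ltW.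
apply: le_trans (_ : Z r s * (1 - q * bar r s + q ^+ 2) <= _); last first.
  rewrite ler_wpM2l ?(ltW (Z_gt0 _ _))//.
  by have := expR_ge1Dx (- (q * bar r s) + q ^+ 2); lra.
have -> : Z r s * (1 - q * bar r s + q ^+ 2) =
    \sum_i E r s i * (1 - q * al i + q ^+ 2).
  transitivity ((1 + q ^+ 2) * Z r s - q * \sum_i al i * E r s i).
    by rewrite sum_bar; ring.
  by rewrite !mulr_sumr -sumrB; apply: eq_bigr => i _; ring.
apply: ler_sum => i _; rewrite [leLHS]/E.
have -> : beta * (be i - al i * (r + e) - s * rate (al i)) =
    beta * (be i - al i * r - s * rate (al i)) + - (q * al i) by rewrite /q; ring.
rewrite expRD ler_wpM2l ?expR_ge0//.
have qa0 : 0 <= q * al i by rewrite mulr_ge0.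
have qaq : q * al i <= q by rewrite ler_piMr.
apply: le_trans (expRN_le_quad qa0) _; nra.
Qed.

Lemma softmax_homo (r s e : R) : 0 <= e -> softmax (r + e) s <= softmax r s.
Proof.
move=> e0; rewrite -(ler_pM2l beta0) -ler_expR !softmaxE; apply: ler_sum => i _.
rewrite ler_expR (ler_pM2l beta0) lerD2r lerD2l lerN2 ler_wpM2l// lerDl//.
Qed.

(* Jensen's inequality for the concave rate makes the softmax a supersolution
   of [v_s = - rate (- v_r)], with an error coming from [v_rr <= beta]. *)
Lemma softmax_supersolution (r s u e : R) : 0 <= u -> 0 < e ->
  softmax r s - u * rate ((softmax r s - softmax (r + e) s) / e)
    - u * (M * (beta * e)) <= softmax r (s + u).
Proof.
move=> u0 e0; apply: le_trans (softmax_s r s u0).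
set x := _ / e; rewrite -addrA -opprD lerD2l lerN2 -mulrDr ler_wpM2l//.
have x0 : 0 <= x by rewrite divr_ge0 ?(ltW e0)// subr_ge0 softmax_homo// ltW.
have bx : bar r s <= x + beta * e.
  rewrite -lerBlDr ler_pdivlMr//; have := softmax_r r s (ltW e0); lra.
have be0 : 0 <= beta * e by rewrite mulr_ge0// ltW.
apply: le_trans (rate_homo bx) _.
by apply: le_trans (rate_lip x0 _) _; [rewrite lerDl | rewrite addrAC subrr add0r].
Qed.

Lemma softmax_ge r s i : be i - al i * r - s * rate (al i) <= softmax r s.
Proof.
rewrite -(ler_pM2l beta0) -ler_expR softmaxE /Z (bigD1 i)//= lerDl sumr_ge0//.
by move=> j _; exact: expR_ge0.
Qed.

Lemma softmax_le r s (m : R) :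
  (forall i, be i - al i * r - s * rate (al i) <= m) ->
  softmax r s <= m + #|I|%:R / beta.
Proof.
move=> le_m; rewrite -(ler_pM2l beta0) -ler_expR softmaxE mulrDr expRD.
rewrite [beta * (_ / _)]mulrC divfK ?gt_eqF//.
apply: le_trans (_ : expR (beta * m) * #|I|%:R <= _).
  rewrite mulr_natr -sumr_const; apply: ler_sum => i _.
  by rewrite ler_expR ler_pM2l.
rewrite ler_wpM2l ?expR_ge0//; have := expR_ge1Dx (#|I|%:R : R); lra.
Qed.

End Softmax.
End Rate.

(** * Upper bound on the deficiency *)

Section Comparison.
Context {R : realType}.

(** Monotonicity under the CFL condition [M <= h]: if the difference grows, it does so by at most x'
    - x, which raises the value of [G] by at most M (x' - x) / h. *)
Lemma upwind_homo (G : R -> R) (M h x y x' y' : R) :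
  (forall x y : R, 0 <= x -> x <= y -> G x <= G y) ->
  (forall x y : R, 0 <= x -> x <= y -> G y <= G x + M * (y - x)) ->
  0 <= M -> M <= h -> 0 < h -> y <= x -> y' <= x' -> x <= x' -> y <= y' ->
  x - G ((x - y) / h) <= x' - G ((x' - y') / h).
Proof.
move=> Gmono Glip M0 Mh h0 yx yx' xx' yy'.
have hV : 0 < h^-1 by rewrite invr_gt0.
have [d|/ltW d] := leP (x' - y') (x - y).
  have : G ((x' - y') / h) <= G ((x - y) / h).
    by rewrite Gmono ?ler_pM2r ?divr_ge0 ?(ltW h0)//; lra.
  lra.
have := Glip ((x - y) / h) ((x' - y') / h).
rewrite divr_ge0 ?(ltW h0) ?subr_ge0// ler_pM2r// => /(_ isT d).
suff : M * ((x' - y') / h - (x - y) / h) <= x' - x by lra.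
rewrite -mulrBl mulrA ler_pdivrMr// mulrC.
apply: le_trans (_ : (x' - x) * M <= _); last by rewrite ler_wpM2l// subr_ge0.
by rewrite ler_wpM2r//; lra.
Qed.

(** Induction on [m]: monotonicity carries the comparison through one step, at the cost of the two
    consistency errors [e] and [e']. *)
Lemma upwind_comparison (D U : nat -> nat -> R) (G : R -> R) (M e e' tau : R)
    (h K m0 : nat) :
  (forall x y : R, 0 <= x -> x <= y -> G x <= G y) ->
  (forall x y : R, 0 <= x -> x <= y -> G y <= G x + M * (y - x)) ->
  0 <= M -> M <= h%:R -> (0 < h)%N -> 0 <= e -> 0 <= e' ->
  (forall k m, D (k + h)%N m <= D k m) ->
  (forall k m, U (k + h)%N m <= U k m) ->
  (forall k m, (k < K)%N -> (m < m0)%N ->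
    D k m.+1 <= D k m - G ((D k m - D (k + h)%N m) / h%:R) + e) ->
  (forall k m, U k m - G ((U k m - U (k + h)%N m) / h%:R) - e' <= U k m.+1) ->
  (forall k, (k < K)%N -> D k 0%N <= U k 0%N + tau) ->
  (forall k m, (K <= k)%N -> D k m <= U k m + tau) ->
  forall m k, (m <= m0)%N -> D k m <= U k m + tau + m%:R * (e + e').
Proof.
move=> Gmono Glip M0 Mh h0 e0 e0' Dh Uh Dstep Ustep Dinit Dlarge m k.
elim: m k => [|m IH] k mm0; have [kK|Kk] := ltnP k K.
- by rewrite mul0r addr0 Dinit.
- by rewrite mul0r addr0 Dlarge.
- apply: le_trans (Dstep k m kK mm0) _.
  pose w := tau + m%:R * (e + e').
  have IHm j : D j m <= U j m + w by rewrite /w addrA IH// ltnW.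
  have h0R : 0 < h%:R :> R by rewrite ltr0n.
  have := upwind_homo (x' := U k m + w) (y' := U (k + h)%N m + w)
    Gmono Glip M0 Mh h0R (Dh k m).
  rewrite lerD2r Uh !IHm => /(_ isT isT isT).
  rewrite (_ : U k m + w - (U (k + h)%N m + w) = U k m - U (k + h)%N m); last by ring.
  by have := Ustep k m; rewrite -[m.+1%:R]natr1 /w; lra.
- apply: le_trans (Dlarge k m.+1 Kk) _; rewrite lerDl mulr_ge0//; lra.
Qed.

End Comparison.

Section UpperBound.
Context {R : realType} {X J : finType} (b c : X -> R).
Hypotheses (b0 : forall x, 0 <= b x) (c0 : forall x, 0 <= c x).
Context (J0 : (0 < #|J|)%N) (mu : law R J).
Local Notation n := (#|J|).
Local Notation rate := (rate b c).
Local Notation M := (mean_degree b c).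
Hypothesis rate_le : forall T : {set J}, rate (#|T|%:R / n%:R) <= hit_prob mu T.

(** The function maximised in Hopf's formula at (0, 1). *)
Definition potential (y : R) : R := expR (- y) * (1 + y) - rate (expR (- y)).

Variable Phi : R.
Hypotheses (Phi0 : 0 <= Phi) (potential_le : forall y, 0 <= y -> potential y <= Phi).

Variable q : nat.
Hypothesis q0 : (0 < q)%N.

(* The slopes [exp (- i / q)] cover all leaf densities up to [q]; the slope 0
   keeps the softmax nonnegative beyond. *)
Let I : finType := option 'I_(q ^ 2).+1.
Let al (i : I) : R := if i is Some i then expR (- (i%:R / q%:R)) else 0.
(** The line be - al r is the tangent to exp(-r) at r = i / q, so the matching affine solution takes
    the value potential(i / q) at (0, 1). *)
Let be (i : I) : R := if i is Some i then al (Some i) * (1 + i%:R / q%:R) else 0.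
(** The power 3 makes the softmax error (q^2 + 2) / q^3 at most 3 / q, while windows of [h] <= n /
    q^4 leaves keep beta h / n at most 1 / q. *)
Let beta : R := q%:R ^+ 3.
Let V := softmax b c al be beta.
Let U k m : R := n%:R * V (k%:R / n%:R) (m%:R / n%:R).
Let D k m := mean_deficiency (nseq k (leaf J0) ++ nseq m mu).
Let h := (n %/ q ^ 4)%N.

Let q0R : 0 < q%:R :> R. Proof. by rewrite ltr0n. Qed.
Let n0R : 0 < n%:R :> R. Proof. by rewrite ltr0n. Qed.
Let beta0 : 0 < beta. Proof. by rewrite exprn_gt0. Qed.
Let al0 i : 0 <= al i. Proof. by case: i => [i|//]; exact: expR_ge0. Qed.
Let al1 i : al i <= 1.
Proof.
case: i => [i|] /=; last by [].
by rewrite -expR0 ler_expR oppr_le0 divr_ge0.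
Qed.

Let rate0 : rate 0 = 0.
Proof. by apply: big1 => x _; rewrite mulr0 oppr0 expR0 subrr mulr0. Qed.

Let M0 : 0 <= M. Proof. exact: mean_degree_ge0. Qed.

Let U_ge0 k m : 0 <= U k m.
Proof.
rewrite mulr_ge0//; apply: le_trans _ (softmax_ge b c (None : I) al be beta0 _ _ None).
by rewrite /= mul0r rate0 mulr0 !subr0.
Qed.

Let U_le : U 0 n <= n%:R * (Phi + 3 / q%:R).
Proof.
rewrite /U ler_wpM2l// mul0r divff ?gt_eqF//.
have : V 0 1 <= Phi + #|I|%:R / beta.
  apply: (softmax_le (None : I)) => // -[i|]; last by rewrite /= mul0r rate0 mulr0 !subr0.
  rewrite mulr0 subr0 mul1r; apply: potential_le; exact: divr_ge0.
move=> /le_trans; apply; rewrite lerD2l card_option card_ord ler_pdivrMr// /beta.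
rewrite (_ : 3 / q%:R * q%:R ^+ 3 = 3 * q%:R ^+ 2); last by field; rewrite gt_eqF.
rewrite -natrX -natrM ler_nat; have : (0 < q ^ 2)%N by rewrite expn_gt0 q0.
lia.
Qed.

Let D_large k m : D k m <= n%:R * expR (- (k%:R / n%:R)).
Proof. exact: expectation_leaves_le. Qed.

Let tau : R := n%:R * (2 / q%:R).

(** The tangent at the grid point [y] just below [r] is under exp(-r) by at most (r - y)^2 <= 1 /
    q. *)
Let D_init k : (k < q * n)%N -> D k 0 <= U k 0 + tau.
Proof.
move=> kK; apply: le_trans (D_large k 0) _; rewrite /U /tau -mulrDr ler_wpM2l//.
have iq : ((k * q) %/ n < (q ^ 2).+1)%N.
  by rewrite ltnS -(leq_pmul2r J0) (leq_trans (leq_divM _ _))//; nia.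
set r := k%:R / n%:R; rewrite mul0r.
apply: le_trans _
  (lerD (softmax_ge b c (None : I) al be beta0 r 0 (Some (Ordinal iq))) (lexx _)).
rewrite mul0r subr0 /= -mulrBr.
set y := _ / q%:R.
have yr : y <= r.
  rewrite /y /r ler_pdivrMr// mulrAC ler_pdivlMr// -!natrM ler_nat.
  exact: leq_divM.
have ry : r - y <= q%:R^-1.
  rewrite lerBlDr -[q%:R^-1]div1r /y -mulrDl /r ler_pdivrMr// mulrAC ler_pdivlMr//.
  by rewrite nat1r -!natrM ler_nat ltnW// ltn_ceil.
have -> : expR (- r) = expR (- y) * expR (- (r - y)).
  by rewrite -expRD; congr expR; ring.
rewrite (_ : 1 + y - r = 1 - (r - y)); last by ring.
have := expRN_le_quad (_ : 0 <= r - y); rewrite subr_ge0 => /(_ yr).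
move=> /(ler_wpM2l (expR_ge0 (- y))).
have ey : expR (- y) <= 1 by rewrite -expR0 ler_expR oppr_le0 divr_ge0.
have : expR (- y) * (r - y) ^+ 2 <= 1 * (q%:R^-1 * 1).
  rewrite ler_pM ?expR_ge0 ?sqr_ge0// expr2 ler_pM ?subr_ge0//.
  by apply: le_trans ry _; rewrite invf_le1// ler1n.
have : 0 <= q%:R^-1 :> R by rewrite invr_ge0.
lra.
Qed.

(** Beyond r = q, exp(-r) <= 1 / q puts [D] below [tau], and [U] is nonnegative. *)
Let D_far k m : (q * n <= k)%N -> D k m <= U k m + tau.
Proof.
move=> Kk; apply: le_trans (D_large k m) _; apply: ler_wpDl; first exact: U_ge0.
rewrite /tau ler_wpM2l// expRN.
apply: le_trans (_ : q%:R^-1 <= _).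
  rewrite lef_pV2 ?posrE ?expR_gt0//; apply: le_trans _ (expR_ge1Dx _).
  rewrite -[leLHS]add0r lerD// ler_pdivlMr// -natrM ler_nat//.
by rewrite -[leLHS]mul1r ler_wpM2r ?invr_ge0//; lra.
Qed.

Let nq_large : 2 * q%:R ^+ 4 * (M + 1) <= n%:R ->
  n%:R <= 2 * q%:R ^+ 4 * h%:R :> R /\ h%:R * q%:R ^+ 4 <= n%:R :> R.
Proof.
move=> nq; split; last by rewrite -natrX -natrM ler_nat leq_divM.
have : (n < (h.+1) * q ^ 4)%N by rewrite ltn_ceil// expn_gt0 q0.
rewrite -(ltr_nat R) natrM natrX -natr1 mulrDl mul1r.
have : 0 <= q%:R ^+ 4 * M :> R by rewrite mulr_ge0// exprn_ge0.
lra.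
Qed.

Lemma mean_deficiency_upper : 2 * q%:R ^+ 4 * (M + 1) <= n%:R ->
  mean_deficiency (nseq n mu)
  <= n%:R * (Phi + (5 + 2 * M) / q%:R) + M * (q%:R + 1) * q%:R ^+ 12.
Proof.
move=> nq; have [nh hn] := nq_large nq.
have q4 : 0 < q%:R ^+ 4 :> R by rewrite exprn_gt0.
have Mh : M + 1 <= h%:R.
  rewrite -(ler_pM2l (_ : 0 < 2 * q%:R ^+ 4)) ?mulr_gt0//.
  exact: le_trans nq nh.
have h0R : 0 < h%:R :> R by have := M0; lra.
have h0 : (0 < h)%N by rewrite -(ltr_nat R).
(* With at most (q + 1) n nodes present, this [t] gives a fluctuation error per step of M / q^4 plus
   a term of order 1 / n, which is [e]. *)
pose t : R := n%:R / q%:R ^+ 8.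
have t0 : 0 < t by rewrite divr_gt0 ?exprn_gt0.
pose e := M * ((q%:R + 1) * q%:R ^+ 12 / n%:R + (q%:R ^+ 4)^-1).
(* Bounds the softmax error M beta h / n. *)
pose e' := M / q%:R.
have e0 : 0 <= e.
  by rewrite mulr_ge0// addr_ge0 ?invr_ge0 ?(ltW q4)// divr_ge0// mulr_ge0 ?exprn_ge0.
have e0' : 0 <= e' by rewrite divr_ge0.
have := @upwind_comparison R D U rate M e e' tau h (q * n) n
  (fun x y _ => @rate_homo _ _ b c b0 c0 x y) (rate_lip b0 c0) M0 _ h0 e0 e0'.
have -> : M <= h%:R by lra.
move=> /(_ isT) /(_ _ _ _ _ D_init D_far n 0%N (leqnn n)) main.
apply: le_trans (main _ _ _ _) _.
- move=> k m; rewrite /D addnC nseqD -catA {1}/mean_deficiency expectation_catC.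
  apply: expectation_le => // c' _; apply: expectation_slow_le; exact: slow_deficiency.
- move=> k m; rewrite /U natrD mulrDl ler_wpM2l//.
  by rewrite (softmax_homo b c (None : I))// divr_ge0.
- move=> k m kK mn; rewrite /D.
  have -> : mean_deficiency (nseq k (leaf J0) ++ nseq m.+1 mu) =
     mean_deficiency (mu :: (nseq k (leaf J0) ++ nseq m mu)).
    by rewrite /mean_deficiency expectation_cat !expectation_cons expectation_cat.
  apply: le_trans (deficiency_scheme J0 _ (fun x y _ => @rate_homo _ _ b c b0 c0 x y)
    (rate_lip b0 c0) rate_le M0 t0 h0) _.
  rewrite catA -nseqD addnC lerD2l size_cat !size_nseq /e -mulrA ler_wpM2l//.
  have km : (k + m)%:R <= (q%:R + 1) * n%:R :> R.
    by rewrite natr1 -natrM ler_nat mulSn addnC leq_add// ltnW.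
  rewrite ler_pdivrMl//.
  apply: le_trans (_ : ((q%:R + 1) * n%:R / t + t) / 2 <= _).
    by rewrite ler_pM2r ?invr_gt0// lerD2r ler_pM2r ?invr_gt0.
  apply: le_trans (_ : n%:R / (2 * q%:R ^+ 4) *
    ((q%:R + 1) * q%:R ^+ 12 / n%:R + (q%:R ^+ 4)^-1) <= _).
    rewrite le_eqVlt; apply/orP; left; apply/eqP; rewrite /t; field.
    by rewrite !gt_eqF.
  by rewrite ler_wpM2r// ler_pdivrMr ?mulr_gt0// mulrC.
- move=> k m; have hn0 : 0 < h%:R / n%:R :> R by rewrite divr_gt0.
  have n0V : 0 <= n%:R^-1 :> R by rewrite invr_ge0.
  have := softmax_supersolution b0 c0 (None : I) be al0 al1 beta0
    (k%:R / n%:R) (m%:R / n%:R) n0V hn0.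
  have -> : k%:R / n%:R + h%:R / n%:R = (k + h)%:R / n%:R :> R by rewrite natrD mulrDl.
  have -> : m%:R / n%:R + n%:R^-1 = m.+1%:R / n%:R :> R by rewrite -natr1 mulrDl div1r.
  rewrite -/V.
  rewrite (_ : (V (k%:R / n%:R) (m%:R / n%:R) - V ((k + h)%:R / n%:R) (m%:R / n%:R)) /
    (h%:R / n%:R) = (U k m - U (k + h)%N m) / h%:R); last first.
    by rewrite /U; field; rewrite !gt_eqF.
  move=> /(ler_wpM2l (ltW n0R)); rewrite -/(U k m.+1); apply: le_trans.
  have -> : U k m = n%:R * V (k%:R / n%:R) (m%:R / n%:R) by [].
  move: (V _ _) (rate _) => v w; rewrite !mulrBr !mulrA divff ?gt_eqF// !mul1r.
  rewrite lerD2l lerN2.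
  have : beta * h%:R / n%:R <= q%:R^-1.
    rewrite ler_pdivrMr// ler_pdivlMl// mulrA -exprS mulrC; exact: hn.
  by move=> /(ler_wpM2l M0); rewrite !mulrA.
have -> : n%:R * (Phi + (5 + 2 * M) / q%:R) =
    n%:R * (Phi + 3 / q%:R) + tau + n%:R * (2 * M / q%:R).
  by rewrite /tau; ring.
apply: le_trans (_ : n%:R * (Phi + 3 / q%:R) + tau + n%:R * (e + e') <= _).
  by rewrite !lerD2r U_le.
suff : n%:R * (e + e') <= n%:R * (2 * M / q%:R) + M * (q%:R + 1) * q%:R ^+ 12 by lra.
have -> : n%:R * (e + e') =
    n%:R * (M / q%:R ^+ 4 + M / q%:R) + M * (q%:R + 1) * q%:R ^+ 12.
  by rewrite /e /e'; field; rewrite !gt_eqF.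
rewrite lerD2r ler_wpM2l// (_ : 2 * M / q%:R = M / q%:R + M / q%:R); last by ring.
rewrite lerD2r ler_wpM2l// lef_pV2 ?posrE// -natrX ler_nat.
by rewrite -[leqLHS]expn1 leq_pexp2l.
Qed.

End UpperBound.

(** * Lower bound on the deficiency *)

Section Thinning.
Context {R : realType} {J : finType}.
Implicit Types (N T A : {set J}) (c : {set J} -> nat) (mu : law R J).

Lemma expectation_insert (l1 l2 : seq (law R J)) mu f :
  expectation (l1 ++ mu :: l2) f = expectation (l1 ++ l2) (step mu f).
Proof. by rewrite expectation_cat expectation_cons -expectation_cat. Qed.

Section ThinLaw.
Context (p : R) (p01 : 0 <= p <= 1) (mu : law R J).

(** With probability 1 - p the node is deleted: its neighbourhood becomes empty. *)
Definition thin_pmf N : R := p * mu N + (1 - p) * (N == set0)%:R.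

Lemma thin_pmf_ge0 N : 0 <= thin_pmf N.
Proof. by case/andP: p01 => *; rewrite addr_ge0// mulr_ge0 ?pmf_ge0 ?subr_ge0. Qed.

Lemma sum_thin_pmf (F : {set J} -> R) :
  \sum_N thin_pmf N * F N = p * (\sum_N mu N * F N) + (1 - p) * F set0.
Proof.
under eq_bigr do rewrite mulrDl -!mulrA.
rewrite big_split/= -!mulr_sumr; congr (_ + _ * _).
rewrite (bigD1 set0)//= eqxx mul1r big1 ?addr0// => N /negPf ->.
by rewrite mul0r.
Qed.

Lemma thin_pmf_sum1 : \sum_N thin_pmf N = 1.
Proof.
under eq_bigr do rewrite -[thin_pmf _]mulr1.
rewrite sum_thin_pmf; under eq_bigr do rewrite mulr1.
by rewrite pmf_sum1; ring.
Qed.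

Definition thin : law R J := Law thin_pmf_ge0 thin_pmf_sum1.

Lemma step_thin f c : step thin f c = p * step mu f c + (1 - p) * f c.
Proof. by rewrite /step sum_thin_pmf add_hit0. Qed.

Lemma hit_prob_thin T : hit_prob thin T = p * hit_prob mu T.
Proof. by rewrite /hit_prob sum_thin_pmf /hit set0I eqxx mulr0 addr0. Qed.

End ThinLaw.

Lemma mean_deficiency_nseqD mu i j :
  mean_deficiency (nseq j mu) <= mean_deficiency (nseq (j + i) mu) + i%:R.
Proof.
elim: i => [|i IH]; first by rewrite addn0 addr0.
suff : mean_deficiency (nseq (j + i) mu) - 1 <= mean_deficiency (nseq (j + i.+1) mu).
  by rewrite -[i.+1%:R]natr1; lra.
rewrite addnS /mean_deficiency /=.
have /(_ no_hit) s := slow_expectation (nseq (j + i) mu) (@slow_deficiency R J).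
set f := expectation _ _ in s *.
rewrite -(step_cst mu (f no_hit - 1) no_hit); apply: step_le => N.
by have := s N; lra.
Qed.

(* Chebyshev for the number of nodes kept by the thinning. *)
Lemma mean_deficiency_thin_le (p : R) (p01 : 0 <= p <= 1) mu (t : R) (n i j : nat) :
  0 < t ->
  mean_deficiency (nseq j mu ++ nseq i (thin p01 mu)) <=
  mean_deficiency (nseq n mu)
    + (((j%:R + i%:R * p - n%:R) ^+ 2 + i%:R * (p * (1 - p))) / t + t) / 2.
Proof.
move=> t0; elim: i j => [|i IH] j.
  rewrite cats0 !mul0r !addr0; set z := _ - _.
  apply: le_trans (_ : mean_deficiency (nseq n mu) + `|z| <= _).
    have [jn|/ltnW nj] := leqP j n.
      have := mean_deficiency_nseqD mu (n - j) j; rewrite subnKC// natrB//.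
      by move/le_trans; apply; rewrite lerD2l -lerN2 /z opprB lerNl -normrN ler_norm.
    apply: ler_wpDr => //; rewrite -(subnKC nj) nseqD /mean_deficiency.
    rewrite expectation_cat.
    apply: expectation_le => // c _; apply/expectation_slow_le/slow_deficiency.
  rewrite lerD2l -real_normK ?num_real//; set w := `|z|.
  rewrite -subr_ge0 (_ : _ - _ = (w - t) ^+ 2 / (2 * t)); last by field; lra.
  by rewrite divr_ge0 ?sqr_ge0//; lra.
(* The next undecided node is kept with probability [p], otherwise deleted; averaging the two bounds
   is the bias-variance identity. *)
have -> : mean_deficiency (nseq j mu ++ nseq i.+1 (thin p01 mu)) =
    p * mean_deficiency (nseq j.+1 mu ++ nseq i (thin p01 mu))
    + (1 - p) * mean_deficiency (nseq j mu ++ nseq i (thin p01 mu)).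
  rewrite /mean_deficiency expectation_insert [nseq j.+1 _ ++ _]/= expectation_cons.
  rewrite -(expectation_cst (nseq j mu ++ nseq i (thin p01 mu)) (1 - p) no_hit).
  rewrite expectation_cst -[(1 - p) * _]addr0.
  rewrite -(expectation_affine _ (1 - p) 0) -expectation_linear; congr expectation.
  by apply/funext => c; rewrite step_thin addr0.
have /andP[p0 p1] := p01.
have := lerD (ler_wpM2l p0 (IH j.+1)) (ler_wpM2l (_ : 0 <= 1 - p) (IH j)).
rewrite subr_ge0 => /(_ p1) /le_trans; apply.
rewrite -[j.+1%:R]natr1 -[i.+1%:R]natr1 le_eqVlt; apply/orP; left; apply/eqP.
by field; lra.
Qed.

End Thinning.

(** Poisson against binomial: each of the [m] factors costs at most x^2. *)
Lemma expRN_natM_le {R : realType} (x : R) m : 0 <= x <= 1 ->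
  expR (- (m%:R * x)) <= (1 - x) ^+ m + m%:R * x ^+ 2.
Proof.
move=> /andP[x0 x1]; elim: m => [|m IH].
  by rewrite !mul0r oppr0 expR0 expr0 addr0.
rewrite -natr1 mulrDl mul1r opprD expRD exprSr.
have ex := expRN_le_quad x0; have e0 := expR_ge0 (- x).
have e1 : expR (- x) <= 1 by rewrite -expR0 ler_expR oppr_le0.
have y0 : 0 <= (1 - x) ^+ m by rewrite exprn_ge0// subr_ge0.
have y1 : (1 - x) ^+ m <= 1 by rewrite exprn_ile1// ?subr_ge0//; lra.
set y := (1 - x) ^+ m in IH y0 y1 *.
have x2 : 0 <= m%:R * x ^+ 2 by rewrite mulr_ge0// sqr_ge0.
apply: le_trans (ler_wpM2r e0 IH) _; rewrite mulrDl.
have := ler_wpM2l y0 ex; have := ler_wpM2l x2 e1.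
have := ler_wpM2r (sqr_ge0 x) y1; lra.
Qed.

(** * Trading supply nodes for leaves *)

Section LowerBound.
Context {R : realType} {X J : finType} (b c : X -> R).
Hypotheses (b0 : forall x, 0 <= b x) (c0 : forall x, 0 <= c x).
Context (J0 : (0 < #|J|)%N) (mu : law R J) (C : R).
Local Notation n := (#|J|).
Local Notation rate := (rate b c).
Local Notation M := (mean_degree b c).
Hypothesis hit_prob_le : forall T : {set J},
  hit_prob mu T <= rate (#|T|%:R / n%:R) + C / n%:R.

Let n0R : 0 < n%:R :> R. Proof. by rewrite ltr0n. Qed.

Let M0 : 0 <= M. Proof. exact: mean_degree_ge0. Qed.

Lemma expectation_unhit (p : R) (p01 : 0 <= p <= 1) j :
  expectation (nseq j (thin p01 (leaf J0))) (fun c => #|unhit c|%:R : R) no_hit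
  = (1 - p / n%:R) ^+ j * n%:R.
Proof.
elim: j => [|j IH].
  by rewrite mul1r /= (_ : unhit no_hit = [set: J]) ?cardsT.
rewrite expectation_cons exprS -mulrA -IH -[RHS]addr0 -expectation_affine.
congr expectation; apply/funext => c'; rewrite step_thin addr0 /step sum_leaf_pmf.
suff -> : \sum_j #|unhit (add_hit [set j] c')|%:R = (n%:R - 1) * #|unhit c'|%:R :> R.
  by field; rewrite gt_eqF.
have -> : (n%:R - 1) * #|unhit c'|%:R =
    \sum_j (#|unhit c'|%:R - (j \in unhit c')%:R) :> R.
  rewrite sumrB sumr_const mulrBl mul1r mulr_natl; congr (_ - _).
  by rewrite -natr_sum -big_mkcond sum1_card.
apply: eq_bigr => k _; rewrite unhit_add_hit (cardsD1 k (unhit c')) natrD.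
by rewrite addrAC subrr add0r.
Qed.

(* Thinning by [K] makes the slope [drate a0 / K] a probability, so that a
   thinned supply node and a thinned leaf can be exchanged one for one. *)
Lemma thin_trade (K : nat) (y : R) (mu' leaf' : law R J) :
  (forall T, hit_prob mu' T = K%:R^-1 * hit_prob mu T) ->
  (forall T, hit_prob leaf' T
    = drate b c (expR (- y)) / K%:R * hit_prob (leaf J0) T) ->
  forall i j,
  mean_deficiency (nseq j leaf' ++ nseq i mu')
  >= mean_deficiency (nseq (i + j) leaf')
     + i%:R * (K%:R^-1 *
         (drate b c (expR (- y)) * expR (- y) - rate (expR (- y)) - C / n%:R)).
Proof.
move=> Hmu Hleaf; set a0 := expR (- y); set k := drate b c a0.
set w := K%:R^-1 * _.
elim=> [|i IH] j; first by rewrite mul0r addr0 cats0.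
have KV : 0 <= K%:R^-1 :> R by rewrite invr_ge0.
have := IH j.+1; rewrite addnS -addSn -[i.+1%:R]natr1 mulrDl mul1r addrA.
suff : mean_deficiency (nseq j.+1 leaf' ++ nseq i mu') + w <=
  mean_deficiency (nseq j leaf' ++ nseq i.+1 mu') by lra.
rewrite /mean_deficiency [nseq j.+1 _ ++ _]/= expectation_cons expectation_insert.
rewrite -[X in X + w]mul1r -expectation_affine; apply: expectation_le => // s ss.
rewrite mul1r !step_deficiency// Hmu Hleaf hit_prob_leaf; set A := critical_set s.
set a := #|A|%:R / n%:R.
(* The tangent at [a0] and the leaf lose the same multiple of [a], so the density of the critical
   set cancels and the constant [w] remains. *)
have := ler_wpM2l KV (hit_prob_le A); have := ler_wpM2l KV (rate_tangent c b0 a0 a).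
rewrite -/a -/k /w; lra.
Qed.

(** Of n K thinned supply nodes about n survive. Trading them all for thinned leaves contributes n
    (k a0 - rate(a0)), up to [C], and about n exp(-k) demand nodes stay isolated; exp(-k) >= a0 (1 +
    y - k) turns the sum into [potential]. *)
Lemma mean_deficiency_lower (K : nat) (y t : R) :
  (0 < K)%N -> M <= K%:R -> 0 <= y -> 0 < t ->
  n%:R * potential b c y - C - M - (n%:R / t + t) / 2
  <= mean_deficiency (nseq n mu).
Proof.
move=> K0 MK y0 t0; set a0 := expR (- y); pose k := drate b c a0.
have K0R : 0 < K%:R :> R by rewrite ltr0n.
have k0 : 0 <= k by exact: drate_ge0.
have kM : k <= M by apply: drate_le => //; exact: expR_ge0.
have K01 : 0 <= (K%:R : R)^-1 <= 1 by rewrite invr_ge0 ler0n invf_le1// ler1n.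
have kK01 : 0 <= k / K%:R <= 1.
  by rewrite divr_ge0//= ler_pdivrMr// mul1r (le_trans kM).
have := thin_trade (hit_prob_thin K01 mu) (hit_prob_thin kK01 (leaf J0)) (n * K) 0.
rewrite addn0 cat0s -/a0 -/k => trade.
have := mean_deficiency_thin_le K01 mu n (n * K) 0 t0.
rewrite cat0s add0r natrM mulfK ?gt_eqF// subrr expr0n add0r.
have -> : n%:R * K%:R * (K%:R^-1 * (1 - K%:R^-1)) = n%:R - n%:R / K%:R :> R.
  by field; rewrite gt_eqF.
move=> cheb.
have {}cheb : mean_deficiency (nseq (n * K) (thin K01 mu)) <=
    mean_deficiency (nseq n mu) + (n%:R / t + t) / 2.
  apply: le_trans cheb _; rewrite lerD2l ler_pM2r ?invr_gt0// lerD2r.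
  by rewrite ler_pM2r ?invr_gt0// gerBl divr_ge0.
have leaves : n%:R * expR (- k) - M <=
    mean_deficiency (nseq (n * K) (thin kK01 (leaf J0))).
  apply: le_trans (_ : expectation (nseq (n * K) (thin kK01 (leaf J0)))
    (fun c => #|unhit c|%:R : R) no_hit <= _); last first.
    by apply: expectation_le => // s ss; rewrite ler_nat unhit_le_deficiency.
  rewrite expectation_unhit; set x := k / K%:R / n%:R.
  have x01 : 0 <= x <= 1.
    case/andP: (kK01) => kK0 kK1; rewrite /x divr_ge0//= ler_pdivrMr// mul1r.
    by rewrite (le_trans kK1)// ler1n.
  have := expRN_natM_le (n * K) x01.
  have -> : (n * K)%:R * x = k by rewrite /x natrM; field; rewrite !gt_eqF.
  have -> : (n * K)%:R * x ^+ 2 = k * (k / K%:R) / n%:R.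
    by rewrite /x natrM; field; rewrite !gt_eqF.
  move=> /(ler_wpM2l (ltW n0R)); rewrite mulrDr mulrCA divff ?gt_eqF// mulr1.
  have : k * (k / K%:R) <= M
    by case/andP: (kK01) => kK0 kK1; rewrite (le_trans _ kM)// ler_piMr.
  lra.
have ek : a0 * (1 + (y - k)) <= expR (- k).
  have -> : expR (- k) = a0 * expR (y - k) by rewrite /a0 -expRD; congr expR; ring.
  by rewrite ler_wpM2l ?expR_ge0// expR_ge1Dx.
have := ler_wpM2l (ltW n0R) ek.
have nK : (n * K)%:R * (K%:R^-1 * (k * a0 - rate a0 - C / n%:R)) =
    n%:R * (k * a0 - rate a0) - C.
  by rewrite natrM; field; rewrite !gt_eqF.
move: trade; rewrite nK /potential -/a0; lra.
Qed.

End LowerBound.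

(** * Matchings and deficiency *)

Section Koenig.
Context {n : nat}.
Implicit Types (E M : {set 'I_n * 'I_n}) (T : {set 'I_n}).

Definition neighbours E (i : 'I_n) : {set 'I_n} := [set j | (i, j) \in E].

Definition hit_count E : {set 'I_n} -> nat :=
  fun T => (\sum_i hit (neighbours E i) T)%N.

(** Beside the supply nodes in [s], each entry of [l] attaches a leaf to a demand node. *)
Definition graph_state E (s l : seq 'I_n) : {set 'I_n} -> nat :=
  foldr (fun i => add_hit (neighbours E i))
    (foldr (fun j => add_hit [set j]) no_hit l) s.

Lemma graph_stateE E s l T :
  graph_state E s l T =
  (\sum_(i <- s) hit (neighbours E i) T + \sum_(j <- l) (j \in T))%N.
Proof.
elim: s => [|i s IH].
  rewrite big_nil add0n; elim: l => [|j l IH]; first by rewrite big_nil.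
  by rewrite big_cons -IH /graph_state /= /add_hit hit1.
by rewrite big_cons -addnA -IH.
Qed.

Lemma submodular_graph_state E s l : submodular (graph_state E s l).
Proof.
elim: s => [|i s IH]; last exact: submodular_add_hit.
by elim: l => [|j l IH]; [exact: submodular_no_hit | exact: submodular_add_hit].
Qed.

Lemma graph_state_leaf E s j l :
  graph_state E s (j :: l) = add_hit [set j] (graph_state E s l).
Proof. by elim: s => //= i s ->; rewrite add_hitC. Qed.

(* The leaves attached to [l] block the demand nodes used so far: whenever a
   new supply node decreases the deficiency, so does a leaf at one of its
   neighbours, to which it can be matched. *)
Lemma matching_exists E s l : uniq s -> exists M,
  [/\ M \subset E, is_matching M,
      forall e, e \in M -> (e.1 \in s) && (e.2 \notin l)
    & (n <= #|M| + #|[set j in l]| + deficiency (graph_state E s l))%N].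
Proof.
elim: s l => [|i s IH] l.
  exists set0; split; first exact: sub0set.
  - by apply/forall_inP => e; rewrite inE.
  - by move=> e; rewrite inE.
  have := leq_deficiency (graph_state E [::] l) (~: [set j in l]).
  rewrite graph_stateE big_nil add0n big1_seq ?addn0; last first.
    by move=> j /andP[_ jl]; rewrite !inE jl.
  have := cardsC [set j in l]; rewrite card_ord cards0 add0n => nE dl.
  by rewrite -{1}nE leq_add2l.
rewrite cons_uniq => /andP[iNs us]; set c := graph_state E s l.
rewrite -[graph_state E (i :: s) l]/(add_hit (neighbours E i) c).
have cs : submodular c := submodular_graph_state E s l.
have := deficiency_add_hit (neighbours E i) cs.
have [/set0Pn|h0] := boolP (neighbours E i :&: critical_set c != set0); last first.
  rewrite /hit (negbTE h0) addn0 => ->.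
  have [M [ME mM Ms nM]] := IH l us; exists M; split=> // e /Ms /andP[es ->].
  by rewrite inE es orbT.
move=> [j]; rewrite inE => /andP[ij jA].
have -> : hit (neighbours E i) (critical_set c) = 1%N.
  by rewrite /hit; case: set0Pn => // -[]; exists j; rewrite inE ij.
have := deficiency_add_hit [set j] cs; rewrite hit1 jA -graph_state_leaf => dj di.
(* The node [i] and a leaf at [j] both lower the deficiency by exactly one, so induction applies
   with [j] blocked. *)
have dd : deficiency (graph_state E s (j :: l)) = deficiency (add_hit (neighbours E i) c).
  by apply: (@addIn 1); rewrite di dj.
have [M [ME mM Ms]] := IH (j :: l) us; rewrite dd => nM.
have [jl|jl] := boolP (j \in l).
  exists M; split=> //.
    by move=> e /Ms /andP[es]; rewrite !inE es orbT negb_or => /andP[].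
  by rewrite set_cons (finset.setUidPr _) ?sub1set ?inE// in nM.
(* The matching from the induction avoids [i] and [j], so their edge can be added. *)
exists ((i, j) |: M); split.
- by rewrite subUset sub1set ME andbT; rewrite inE in ij.
- apply/forall_inP => e eM; apply/forall_inP => f fM; apply/implyP.
  move: eM fM; rewrite !inE => /orP[/eqP ->|eM] /orP[/eqP ->|fM]; rewrite ?eqxx//= => ef.
  + have /andP[fs] := Ms f fM; rewrite inE negb_or eq_sym => /andP[-> _].
    by rewrite andbT; apply: contraNneq iNs => ->.
  + have /andP[es] := Ms e eM; rewrite inE negb_or => /andP[-> _].
    by rewrite andbT; apply: contraNneq iNs => <-.
  + by move: mM => /forall_inP/(_ e eM)/forall_inP/(_ f fM); rewrite ef.
- move=> e; rewrite !inE => /orP[/eqP ->/=|/Ms]; first by rewrite eqxx jl.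
  by rewrite inE negb_or => /and3P[-> _ ->]; rewrite orbT.
rewrite cardsU1; have -> : (i, j) \notin M.
  by apply/negP => /Ms; rewrite /= mem_head andbF.
by move: nM; rewrite set_cons cardsU1 inE jl addnCA addnA.
Qed.

(** Edges of [M] into [T] start at distinct supply nodes that hit [T]; the others end at distinct
    nodes outside [T]. *)
Lemma matching_le E M T : M \subset E -> is_matching M ->
  (#|M| + #|T| <= n + hit_count E T)%N.
Proof.
move=> ME /forall_inP mM.
have inj1 : {in M &, injective (fun e => e.1 : 'I_n)}.
  move=> e f eM fM ef; apply/eqP; apply: contraT => nef.
  by have /forall_inP/(_ f fM) := mM e eM; rewrite nef ef eqxx.
have inj2 : {in M &, injective (fun e => e.2 : 'I_n)}.
  move=> e f eM fM ef; apply/eqP; apply: contraT => nef.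
  by have /forall_inP/(_ f fM) := mM e eM; rewrite nef ef eqxx andbF.
rewrite -(cardsID [set e | e.2 \in T] M).
have : (#|M :&: [set e | e.2 \in T]| <= hit_count E T)%N.
  rewrite -(card_in_imset (f := fun e => e.1)); last first.
    by move=> e f; rewrite !inE => /andP[eM _] /andP[fM _]; exact: inj1.
  rewrite /hit_count -sum1_card big_mkcond; apply: leq_sum => i _.
  case: imsetP => [[e]|//]; rewrite !inE => /andP[eM eT] ->.
  rewrite /hit; case: eqP => // /setP/(_ e.2); rewrite !inE eT -surjective_pairing.
  by rewrite (fintype.subsetP ME e eM).
have : (#|M :\: [set e | e.2 \in T]| <= #|~: T|)%N.
  rewrite -(card_in_imset (f := fun e => e.2)); last first.
    by move=> e f; rewrite !inE => /andP[_ eM] /andP[_ fM]; exact: inj2.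
  apply: subset_leq_card; apply/fintype.subsetP => j /imsetP[e].
  by rewrite !inE => /andP[eT _] ->.
move=> outT inT; apply: leq_trans (leq_add (leq_add inT outT) (leqnn #|T|)) _.
by rewrite -addnA [(#|~: T| + _)%N]addnC cardsC card_ord addnC.
Qed.

(** Koenig's theorem: a tight set bounds every matching, and the construction through all supply
    nodes, with nothing blocked at first, attains the bound. *)
Lemma max_matching_deficiency E :
  (max_matching_size E + deficiency (hit_count E))%N = n.
Proof.
have hE : hit_count E = graph_state E (enum 'I_n) [::].
  by apply/funext => T; rewrite graph_stateE big_nil addn0 big_enum.
apply/eqP; rewrite eqn_leq; apply/andP; split.
  have [|T /eqP tT] := @tight_exists _ (hit_count E).
    by rewrite /hit_count big1// => i _; rewrite hit0.
  have Tn : (#|T| <= n + hit_count E T)%N.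
    by rewrite (leq_trans (max_card _))// card_ord leq_addr.
  suff : (max_matching_size E <= n + hit_count E T - #|T|)%N.
    by rewrite leq_subRL// tT; lia.
  apply/bigmax_leqP => M /andP[ME mM].
  by rewrite leq_subRL// addnC; exact: matching_le.
have [M [ME mM _]] := matching_exists E [::] (enum_uniq 'I_n).
rewrite -hE (_ : [set j in [::]] = set0) ?cards0 ?addn0; last first.
  by apply/setP => j; rewrite !inE.
move/leq_trans; apply; rewrite leq_add2r.
by apply: (leq_bigmax_cond (F := fun M => #|M|)); rewrite ME.
Qed.

End Koenig.

(** * The one-sided random graph *)

Section NodeLaw.
Context {R : realType} {X J : finType} (b p : X -> R).
Hypotheses (b0 : forall x, 0 <= b x) (b1 : \sum_x b x = 1).
Hypothesis p01 : forall x, 0 <= p x <= 1.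
Implicit Types (N T : {set J}).

Definition node_pmf N : R := \sum_x b x * \prod_j bernoulli_pmf (p x) (j \in N).

Lemma node_pmf_ge0 N : 0 <= node_pmf N.
Proof.
apply: sumr_ge0 => x _; rewrite mulr_ge0// prodr_ge0// => j _.
exact: bernoulli_pmf_ge0.
Qed.

Lemma sum_prod_setE (F G : J -> R) :
  \sum_(N : {set J}) \prod_j (if j \in N then F j else G j) = \prod_j (F j + G j).
Proof. by rewrite bigA_distr; apply: eq_bigl => N; rewrite inE. Qed.

Lemma node_pmf_sum1 : \sum_N node_pmf N = 1.
Proof.
rewrite exchange_big/= -[RHS]b1; apply: eq_bigr => x _; rewrite -mulr_sumr.
rewrite [X in b x * X](_ : _ = 1) ?mulr1//.
rewrite /bernoulli_pmf sum_prod_setE big1// => j _; ring.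
Qed.

Definition node_law : law R J := Law node_pmf_ge0 node_pmf_sum1.

Lemma hit_prob_node T :
  hit_prob node_law T = \sum_x b x * (1 - (1 - p x) ^+ #|T|).
Proof.
rewrite /hit_prob /=; under eq_bigr do rewrite mulr_suml.
rewrite exchange_big/=; apply: eq_bigr => x _.
under eq_bigr do rewrite -mulrA; rewrite -mulr_sumr; congr (_ * _).
(* Total mass minus the mass of the sets avoiding [T], both as sums over subsets. *)
transitivity (\prod_(j : J) (p x + (1 - p x))
    - \prod_(j : J) ((if j \in T then 0 else p x) + (1 - p x))); last first.
  congr (_ - _); first by rewrite big1// => j _; ring.
  rewrite -prodr_const [RHS]big_mkcond; apply: eq_bigr => j _.
  by case: ifP => _; ring.
rewrite -!sum_prod_setE -sumrB; apply: eq_bigr => N _; rewrite /hit /bernoulli_pmf.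
have [NT|/set0Pn[j]] := eqVneq (N :&: T) set0.
  rewrite mulr0; apply/esym/eqP; rewrite subr_eq0; apply/eqP/eq_bigr => j _.
  case: ifP => // jN; case: ifP => // jT.
  by have := in_set0 j; rewrite -NT inE jN jT.
rewrite inE => /andP[jN jT]; rewrite mulr1.
have -> : \prod_k (if k \in N then if k \in T then 0 else p x else 1 - p x) = 0.
  by rewrite (bigD1 j)//= jN jT mul0r.
by rewrite subr0.
Qed.

End NodeLaw.

Section NodeLawRate.
Context {R : realType} {X J : finType} (b c : X -> R).
Hypotheses (b0 : forall x, 0 <= b x) (b1 : \sum_x b x = 1).
Hypothesis J0 : (0 < #|J|)%N.
Local Notation n := (#|J|).
Context (p : X -> R) (p01 : forall x, 0 <= p x <= 1).
Hypothesis pE : forall x, p x = c x / n%:R.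
Local Notation mu := (node_law (J := J) b0 b1 p01).

Let n0R : 0 < n%:R :> R. Proof. by rewrite ltr0n. Qed.

Let exponentE x (k : nat) : c x * (k%:R / n%:R) = k%:R * p x.
Proof. by rewrite pE mulrCA. Qed.

Lemma rate_le_hit_prob (T : {set J}) : rate b c (#|T|%:R / n%:R) <= hit_prob mu T.
Proof.
rewrite hit_prob_node; apply: ler_sum => x _; rewrite ler_wpM2l// lerD2l lerN2.
rewrite exponentE -[- (#|T|%:R * _)]mulrN expRM_natl; apply: lerXn2r.
- by rewrite nnegrE subr_ge0; case/andP: (p01 x).
- by rewrite nnegrE expR_ge0.
- exact: expR_ge1Dx.
Qed.

Lemma hit_prob_le_rate (T : {set J}) :
  hit_prob mu T <= rate b c (#|T|%:R / n%:R) + (\sum_x b x * c x ^+ 2) / n%:R.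
Proof.
rewrite hit_prob_node /rate mulr_suml -big_split/=; apply: ler_sum => x _.
rewrite -mulrA -mulrDr ler_wpM2l// exponentE.
have := expRN_natM_le #|T| (p01 x).
suff : #|T|%:R * p x ^+ 2 <= c x ^+ 2 / n%:R by lra.
have -> : c x ^+ 2 / n%:R = n%:R * p x ^+ 2 by rewrite pE; field; rewrite gt_eqF.
by rewrite ler_wpM2r ?sqr_ge0// ler_nat max_card.
Qed.

End NodeLawRate.

(** * From the random graph to independent neighbourhoods *)

Section Link.
Context {R : realType} {n : nat}.
Local Notation J := 'I_n.

Lemma expectation_nseqE m (mu : law R J) f (s : {set J} -> nat) :
  expectation (nseq m mu) f s =
  \sum_(g : {ffun 'I_m -> {set J}}) (\prod_i mu (g i)) *
     f (fun T => (\sum_i hit (g i) T + s T)%N).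
Proof.
elim: m s => [|m IH] s.
  rewrite /= (big_pred1 [ffun=> set0]); last first.
    by move=> g /=; apply/esym/eqP/ffunP => -[].
  rewrite big_ord0 mul1r; congr f; apply/funext => T.
  by rewrite big_ord0.
rewrite -[LHS]/(step mu (expectation (nseq m mu) f) s) /step.
under eq_bigr do rewrite IH mulr_sumr.
rewrite pair_bigA/=.
pose h (u : {set J} * {ffun 'I_m -> {set J}}) : {ffun 'I_m.+1 -> {set J}} :=
  [ffun i => if unlift ord0 i is Some k then u.2 k else u.1].
pose h' (g : {ffun 'I_m.+1 -> {set J}}) := (g ord0, [ffun k => g (lift ord0 k)]).
have hK : cancel h h'.
  move=> [N g]; congr pair; first by rewrite ffunE unlift_none.
  by apply/ffunP => k; rewrite !ffunE liftK.
have h'K : cancel h' h.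
  move=> g; apply/ffunP => i; rewrite ffunE /=.
  by case: unliftP => [k ->|->]; rewrite ?ffunE.
rewrite [RHS](reindex h) /=; last by exists h' => x _; [exact: hK | exact: h'K].
apply: eq_bigr => -[N g] _ /=; rewrite big_ord_recl mulrA; congr (_ * _ * f _).
- by rewrite ffunE unlift_none.
- by apply: eq_bigr => i _; rewrite ffunE liftK.
apply/funext => T; rewrite big_ord_recl /add_hit ffunE unlift_none addnCA addnA.
by congr (_ + _ + _)%N; apply: eq_bigr => i _; rewrite ffunE liftK.
Qed.

Lemma sum_neighbours (F : {ffun J -> {set J}} -> R) :
  \sum_(E : {set J * J}) F [ffun i => neighbours E i] = \sum_g F g.
Proof.
pose h' (g : {ffun J -> {set J}}) : {set J * J} := [set e | e.2 \in g e.1].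
rewrite [RHS](reindex (fun E => [ffun i => neighbours E i]))//.
exists h' => [E|g] _.
  by apply/setP => -[i j]; rewrite !inE ffunE inE.
by apply/ffunP => i; rewrite ffunE; apply/setP => j; rewrite !inE.
Qed.

Context (B : R) (C : 'M[R]_2).
Hypothesis (B01 : 0 <= B <= 1).

Lemma type_prob_ge0 x : 0 <= type_prob B x.
Proof. exact: bernoulli_pmf_ge0. Qed.

Lemma type_prob_sum1 : \sum_x type_prob B x = 1.
Proof. by rewrite !big_ord_recl big_ord0 /type_prob /bernoulli_pmf /=; ring. Qed.

Hypothesis p01 : forall x, 0 <= edge_prob C n x 0 <= 1.
Local Notation mu := (node_law (J := J) type_prob_ge0 type_prob_sum1 p01).

(** A graph is the family of its supply neighbourhoods; as all demand nodes are regular, these are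
    independent once supply types are averaged out. *)
Lemma expected_max_matchingE :
  expected_max_matching B 0 C n = n%:R - mean_deficiency (nseq n mu).
Proof.
have -> : n%:R - mean_deficiency (nseq n mu) =
    expectation (nseq n mu) (fun s => -1 * deficiencyR s + n%:R) no_hit.
  by rewrite expectation_affine mulN1r addrC.
rewrite expectation_nseqE -sum_neighbours /expected_max_matching.
(* As [bR] is 0, any demand type assignment other than the all-regular one has probability 0. *)
pose t0 : {ffun J -> 'I_2} := [ffun=> 0].
under eq_bigr => tL _.
  rewrite (bigD1 t0)//= [X in _ + X]big1 ?addr0; last first.
    move=> tR ntR; apply: big1 => E _.
    have [j /eqP tRj] : exists j, tR j != 0.
      apply/existsP; rewrite -negb_forall; apply: contra ntR => /forallP tR0.
      by apply/eqP/ffunP => j; rewrite ffunE; apply/eqP/tR0.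
    rewrite /graph_pmf [X in _ * X * _ * _](bigD1 j)//= /type_prob /bernoulli_pmf.
    suff -> : tR j == 1 by rewrite !(mul0r, mulr0).
    by case: (tR j) tRj => [[|[|?]] ?] // tRj; case: tRj; apply/val_inj.
  over.
rewrite exchange_big/=; apply: eq_bigr => E _; rewrite -mulr_suml.
congr (_ * _); last first.
  rewrite /deficiencyR (_ : (fun _ => _) = hit_count E); last first.
    by apply/funext => T; rewrite addn0; apply: eq_bigr => i _; rewrite ffunE.
  have /(congr1 (fun k => k%:R : R)) := max_matching_deficiency E.
  by rewrite natrD; lra.
under [RHS]eq_bigr => i _.
  rewrite ffunE /=.
  over.
rewrite /= /node_pmf bigA_distr_bigA /=; apply: eq_bigr => tL _.
rewrite /graph_pmf [X in _ * X * _]big1 ?mulr1; last first.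
  by move=> j _; rewrite ffunE /type_prob /bernoulli_pmf /= subr0.
rewrite big_split/=; congr (_ * _); rewrite pair_bigA; apply: eq_bigr => -[i j] _ /=.
by rewrite ffunE inE.
Qed.

End Link.

(** * Maximisation of [F_OS] and passage to the limit *)

Section OneSided.
Context {R : realType} (B alpha alphaf : R).
Hypotheses (hB0 : 0 < B) (hB1 : B <= 1) (halpha : 0 <= alpha).
Hypothesis (halphaf : alpha <= alphaf).
Local Notation C := (flex_matrix alpha alphaf).
Local Notation b := (type_prob B).
Let c (x : 'I_2) : R := C x 0.
Local Notation M := (mean_degree b c).

Let B01 : 0 <= B <= 1. Proof. by rewrite hB1 ltW. Qed.

Let c0 x : 0 <= c x.
Proof. by rewrite /c mxE; case: ifP => _ /=; have := halpha; have := halphaf; lra. Qed.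

Let b0 : forall x, 0 <= b x := type_prob_ge0 B01.

Let sum_types (f : 'I_2 -> R) : \sum_x b x * f x = (1 - B) * f 0 + B * f 1.
Proof.
rewrite !big_ord_recl big_ord0 addr0 /type_prob /bernoulli_pmf /=.
by congr (_ + _ * f _); apply/val_inj.
Qed.

Let M0 : 0 <= M. Proof. exact: mean_degree_ge0. Qed.

Lemma mean_degreeE : M = 2 * alpha + (alphaf - alpha) * B.
Proof. by rewrite /mean_degree sum_types /c !mxE /=; ring. Qed.

Lemma F_OS_potential t : F_OS B alpha alphaf t = potential b c (M * t).
Proof.
rewrite /F_OS -mean_degreeE /potential /rate sum_types /c !mxE /= !mulNr; ring.
Qed.

Lemma continuous_F_OS : continuous (F_OS B alpha alphaf).
Proof.
move=> t; rewrite /F_OS; set M' := 2 * _ + _.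
have cM : ((fun x : R => M' * x) x @[x --> t] --> M' * t)%classic.
  by apply: cvgM; [exact: cvg_cst|exact: cvg_id].
have cE : ((fun x : R => expR (- (M' * x))) x @[x --> t] --> expR (- (M' * t)))%classic.
  by apply: (cvg_comp _ _ (cvgN cM)); exact: continuous_expR.
have cE2 (k : R) : ((fun x : R => expR (k * expR (- (M' * x)))) x @[x --> t]
    --> expR (k * expR (- (M' * t))))%classic.
  apply: (cvg_comp _ _ (cvgM (cvg_cst k) cE)); exact: continuous_expR.
apply: cvgB; last exact: cvg_cst.
apply: cvgD; last by apply: cvgM => //; apply: cvgD => //; exact: cvg_cst.
by apply: cvgD; (apply: cvgM; [exact: cvg_cst|exact: cE2]).
Qed.

(** The derivative exp(-y) (drate(exp(-y)) - y) is nonpositive past [M], since drate <= M. This is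
    why t in [0, 1] covers the maximum over all y >= 0. *)
Lemma potential_tail y : M <= y -> potential b c y <= potential b c M.
Proof.
move=> My; rewrite /potential.
have ey : expR (- y) <= expR (- M) by rewrite ler_expR lerN2.
have := rate_lip b0 c0 (expR_ge0 (- y)) ey.
have : expR (- y) * (1 + (y - M)) <= expR (- M).
  rewrite (_ : expR (- M) = expR (- y) * expR (y - M)).
    by rewrite ler_wpM2l ?expR_ge0// expR_ge1Dx.
  by rewrite -expRD; congr expR; ring.
lra.
Qed.

Lemma F_OS_max : exists t1, [/\ 0 <= t1 <= 1,
  forall t, 0 <= t <= 1 -> F_OS B alpha alphaf t <= F_OS B alpha alphaf t1
  & forall y, 0 <= y -> potential b c y <= F_OS B alpha alphaf t1].
Proof.
have [|t1 t1I max_t1] := EVT_max (@ler01 R) (f := F_OS B alpha alphaf).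
  exact/continuous_subspaceT/continuous_F_OS.
exists t1; split.
- by move: t1I; rewrite in_itv.
- by move=> t tI; apply: max_t1; rewrite in_itv.
move=> y y0; have [yM|/ltW My] := leP y M; last first.
  apply: le_trans (potential_tail My) _.
  by rewrite -[X in potential _ _ X]mulr1 -F_OS_potential max_t1// in_itv /= ler01 lexx.
(* If [M] is 0, y = M t cannot be solved by division, but y <= M forces y = 0. *)
have [M_eq0|M_neq0] := eqVneq M 0.
  have -> : y = M * 0 by rewrite mulr0; apply/eqP; rewrite eq_le y0 -M_eq0 yM.
  by rewrite -F_OS_potential max_t1// in_itv /= ler01 lexx.
have Mgt0 : 0 < M by rewrite lt_def M_neq0.
have -> : y = M * (y / M) by rewrite mulrCA divff// mulr1.
rewrite -F_OS_potential max_t1// in_itv /= divr_ge0//=.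
by rewrite ler_pdivrMr// mul1r.
Qed.

Let edge_prob01 n : forall x, 0 <= edge_prob C n x 0 <= 1.
Proof.
move=> x; rewrite /edge_prob ge_min lexx andbT le_min ler01 divr_ge0//.
exact: c0.
Qed.

Let D n : R := mean_deficiency (nseq n
  (node_law (J := 'I_n) (type_prob_ge0 B01) (type_prob_sum1 B) (edge_prob01 n))).

Let matching_rateE n : (0 < n)%N -> matching_rate B 0 C n = 1 - D n / n%:R.
Proof.
move=> n0; rewrite /matching_rate (expected_max_matchingE B01 (edge_prob01 n)).
by rewrite mulrBl divff// pnatr_eq0 -lt0n.
Qed.

Let edge_probE n x : (0 < n)%N -> 2 * alpha + (alpha + alphaf) <= n%:R ->
  edge_prob C n x 0 = c x / #|'I_n|%:R.
Proof.
move=> n0 nC; rewrite card_ord /edge_prob min_r// ler_pdivrMr ?ltr0n// mul1r.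
apply: le_trans nC; have := halpha; have := halphaf.
by rewrite mxE; case: ifP => _ /=; lra.
Qed.

Lemma matching_rate_cvg (Phi y : R) : 0 <= y -> potential b c y = Phi ->
  (forall y : R, 0 <= y -> potential b c y <= Phi) ->
  (matching_rate B 0 C n @[n --> \oo] --> 1 - Phi)%classic.
Proof.
move=> y0 yPhi Phi_ge.
(* At y = 0 the potential is 1 - rate(1), which is nonnegative. *)
have Phi0 : 0 <= Phi.
  apply: le_trans (Phi_ge 0 (lexx _)).
  rewrite /potential oppr0 expR0 addr0 mulr1 subr_ge0 -[leRHS](type_prob_sum1 B).
  by apply: ler_sum => x _; rewrite mulr1 ler_piMr// gerBl expR_ge0.
apply/cvgrPdist_le => e e0.
(* With [q] fixed first, the part of the upper error proportional to n is at most e n / 2; the rest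
   does not grow with n. *)
pose q := (Num.bound (2 * (5 + 2 * M) / e)).+1.
have q0 : 0 < q%:R :> R by rewrite ltr0n.
have q_large : (5 + 2 * M) / q%:R <= e / 2.
  have : 2 * (5 + 2 * M) / e <= q%:R.
    rewrite /q -[leRHS]natr1; apply: ler_wpDr => //; apply/ltW/archi_boundP.
    by rewrite divr_ge0 ?(ltW e0)//; have := M0; lra.
  by rewrite ler_pdivrMr// ler_pdivrMr//; lra.
pose K := (Num.bound M).+1.
have MK : M <= K%:R.
  by rewrite -natr1; apply: ler_wpDr => //; apply/ltW/archi_boundP.
pose C2 := \sum_x b x * c x ^+ 2.
near=> n.
have n0R : 0 < n%:R :> R by near: n; exact: nbhs_infty_gtr.
have n0 : (0 < n)%N by rewrite -(ltr_nat R).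
have J0 : (0 < #|'I_n|)%N by rewrite card_ord.
have nC : 2 * alpha + (alpha + alphaf) <= n%:R by near: n; exact: nbhs_infty_ger.
have pE x := edge_probE x n0 nC.
have nq : 2 * q%:R ^+ 4 * (M + 1) <= #|'I_n|%:R.
  by rewrite card_ord; near: n; exact: nbhs_infty_ger.
have upper := mean_deficiency_upper b0 c0 J0
  (rate_le_hit_prob b0 (type_prob_sum1 B) (edge_prob01 n) pE) Phi0 Phi_ge
  (ltn0Sn _ : 0 < q)%N nq.
(* Taking t = e n makes the Chebyshev error e n / 2 plus a constant. *)
have lower := mean_deficiency_lower b0 c0 J0
  (hit_prob_le_rate b0 (type_prob_sum1 B) J0 (edge_prob01 n) pE)
  (ltn0Sn _ : 0 < K)%N MK y0 (_ : 0 < e * #|'I_n|%:R).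
have {}lower := lower (mulr_gt0 e0 _).
move: upper lower; rewrite !card_ord yPhi -/(D n) => upper /(_ n0R) lower.
rewrite matching_rateE// opprB addrC addrA subrK.
rewrite (_ : D n / n%:R - Phi = (D n - n%:R * Phi) / n%:R); last by field; rewrite gt_eqF.
rewrite normrM [`|n%:R^-1|]gtr0_norm ?invr_gt0// ler_pdivrMr// ler_norml.
apply/andP; split.
  have e_n : n%:R / (e * n%:R) = e^-1 by field; rewrite !gt_eqF.
  move: lower; rewrite -/C2 e_n.
  have : 2 * (C2 + M + e^-1 / 2) / e <= n%:R by near: n; exact: nbhs_infty_ger.
  by rewrite ler_pdivrMr//; lra.
have : 2 * (M * (q%:R + 1) * q%:R ^+ 12) / e <= n%:R by near: n; exact: nbhs_infty_ger.
have := ler_wpM2l (ltW n0R) q_large.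
by rewrite ler_pdivrMr//; lra.
Unshelve. all: by end_near. Qed.

End OneSided.

Local Open Scope classical_set_scope.
Local Open Scope ring_scope.

(* The limit defining eta_OS exists, the maximum of F_OS on [0, 1] is attained
   at some t1, and eta_OS is 1 minus this maximum. *)
Theorem corollary2 (R : realType) (B alpha alphaf : R)
    (hB0 : 0 < B) (hB1 : B <= 1) (halpha : 0 <= alpha)
    (halphaf : alpha <= alphaf) :
  cvgn (matching_rate B 0 (flex_matrix alpha alphaf)) /\
  exists t1 : R,
    [/\ 0 <= t1 <= 1,
        forall t : R, 0 <= t <= 1 ->
          F_OS B alpha alphaf t <= F_OS B alpha alphaf t1
      & eta_OS B alpha alphaf = 1 - F_OS B alpha alphaf t1].
Proof.
have [t1 [t1I max_t1 max_y]] := F_OS_max hB0 hB1 halpha halphaf.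
have t10 : 0 <= mean_degree (type_prob B) (fun x => flex_matrix alpha alphaf x 0) * t1.
  by case/andP: t1I => t10 _; rewrite mulr_ge0// mean_degreeE; nra.
have lim_rate := matching_rate_cvg hB0 hB1 halpha halphaf t10
  (esym (F_OS_potential _ _ _ _)) max_y.
split; first by apply/cvg_ex; eexists; exact: lim_rate.
by exists t1; split=> //; apply: cvg_lim.
Qed.
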